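(* For every integer $k\ge 1$ there is a constant $C_k>0$, depending only on $k$, such that the following holds. Let $(S,\mathcal S)$ be a measurable space, $(B,\|\cdot\|)$ a Banach space, $\{X_i\}$ a sequence of independent random variables with values in $S$, and $\{X_i^{(1)}\},\{X_i^{(2)}\},\dots,\{X_i^{(k)}\}$ be $k$ independent copies of the sequence $\{X_i\}$. Let $n\ge k$ and let $f_{i_1\cdots i_k}:S^k\to B$ be measurable functions, indexed by $(i_1,\dots,i_k)$. Then $$P\left(\left\|\sum_{1\le i_1\ne\cdots\ne i_k\le n} f_{i_1\cdots i_k}(X_{i_1},\dots,X_{i_k})\right\|\ge t\right)\le C_k\,P\left(C_k\left\|\sum_{1\le i_1\ne\cdots\ne i_k\le n} f_{i_1\cdots i_k}(X_{i_1}^{(1)},\dots,X_{i_k}^{(k)})\right\|\ge t\right)\quad\text{for all } t>0.$$ Moreover, if the functions satisfy the condition $$f_{i_1\cdots i_k}(X_{i_1},\dots,X_{i_k})=f_{i_{\pi(1)}\cdots i_{\pi(k)}}(X_{i_{\pi(1)}},\dots,X_{i_{\pi(k)}})$$ for all permutations $\pi$ of $\{1,\dots,k\}$ (and all indices $i_1,\dots,i_k$ occurring in the sums), then the reverse inequality holds: $$P\left(\left\|\sum_{1\le i_1\ne\cdots\ne i_k\le n} f_{i_1\cdots i_k}(X_{i_1},\dots,X_{i_k})\right\|\ge t\right)\ge \frac{1}{C_k}\,P\left(\frac{1}{C_k}\left\|\sum_{1\le i_1\ne\cdots\ne i_k\le n} f_{i_1\cdots i_k}(X_{i_1}^{(1)},\dots,X_{i_k}^{(k)})\right\|\ge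 t\right)\quad\text{for all } t>0.$$
   Context: The notation $1\le i_1\ne\cdots\ne i_k\le n$ means that the sum is over all $k$-tuples $(i_1,\dots,i_k)\in\{1,\dots,n\}^k$ with $i_r\ne i_s$ for all $1\le r\ne s\le k$. The random variables $X_i$ are independent but need not be identically distributed. ''$k$ independent copies of $\{X_i\}$'' means that the $k$ sequences $\{X_i^{(1)}\},\dots,\{X_i^{(k)}\}$ are mutually independent and each has the same distribution (as a sequence) as $\{X_i\}$. ''Depending only on $k$'' means that $C_k$ does not depend on $n$, $t$, the spaces $S$ and $B$, the functions $f_{i_1\cdots i_k}$, or the distributions of the $X_i$. *)

(* Defs.v *)
From HB Require Import structures.
From mathcomp Require Import all_boot all_order all_algebra all_fingroup.
From mathcomp Require Import finmap.
From mathcomp Require Import all_classical all_reals all_analysis.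

Set Implicit Arguments.
Unset Strict Implicit.
Unset Printing Implicit Defensive.

Import Order.TTheory GRing.Theory Num.Theory.
Import numFieldNormedType.Exports.

Local Open Scope classical_set_scope.
Local Open Scope ring_scope.

Definition mutually_independent (d : measure_display) (T : measurableType d)
    (R : realType) (P : probability T R) (I : choiceType)
    (d' : measure_display) (E : measurableType d') (X : I -> T -> E) : Prop :=
  forall (J : {fset I}) (A : I -> set E),
    (forall i, i \in J -> measurable (A i)) ->
    P (\bigcap_(i in [set` J]) X i @^-1` A i) =
    (\prod_(i <- J) P (X i @^-1` A i))%E.

Definition same_law (d : measure_display) (T : measurableType d)
    (R : realType) (P : probability T R)
    (d' : measure_display) (E : measurableType d') (X Y : T -> E) : Prop :=
  forall A : set E, measurable A -> P (X @^-1` A) = P (Y @^-1` A).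

Definition cylinders (d : measure_display) (S : measurableType d) :
    set (set (nat -> S)) :=
  \bigcup_i preimage_set_system [set: nat -> S] (fun x => x i) measurable.

(* The space of S-valued sequences with its product sigma-algebra. *)
Definition seq_space (d : measure_display) (S : measurableType d) :=
  g_sigma_algebraType (@cylinders d S).

Definition seq_rv (T : Type) (d : measure_display) (S : measurableType d)
    (X : nat -> T -> S) : T -> seq_space S :=
  fun w i => X i w.

(* Only the joint law of the copies is constrained: they need not be
   independent of X itself. *)
Definition independent_copies (d : measure_display) (T : measurableType d)
    (R : realType) (P : probability T R)
    (d' : measure_display) (S : measurableType d') (k : nat)
    (X : nat -> T -> S) (Y : 'I_k -> nat -> T -> S) : Prop :=
  mutually_independent P (fun j => seq_rv (Y j)) /\
  forall j, same_law P (seq_rv (Y j)) (seq_rv X).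

(* Measurability of a Banach-space valued map, in the usual strong sense: Borel
   measurable with separable range, i.e. Borel measurable when B is separable.
   For nonseparable B, mere Borel measurability is not stable under sums, and
   the norms of the sums considered below need not be random variables. *)
Definition strongly_measurable (d : measure_display) (T : measurableType d)
    (R : realType) (B : completeNormedModType R) (f : T -> B) : Prop :=
  measurable_fun [set: T] (f : T -> g_sigma_algebraType (@open B)) /\
  exists2 D : set B, countable D & range f `<=` closure D.

(* The sum over all k-tuples of pairwise distinct indices of
   f_i (Y 0 (i 0), ..., Y (k-1) (i (k-1))); indices start at 0.  The constant
   family Y = fun=> X gives the undecoupled sum. *)
Definition offdiag_sum (R : realType) (B : completeNormedModType R)
    (T S : Type) (k n : nat) (f : {ffun 'I_k -> 'I_n} -> k.-tuple S -> B)
    (Y : 'I_k -> nat -> T -> S) (w : T) : B :=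
  \sum_(i : {ffun 'I_k -> 'I_n} | injectiveb i)
    f i [tuple Y j (i j) w | j < k].

(* Main.v *)
Require Import Defs.
From HB Require Import structures.
From mathcomp Require Import all_boot all_order all_algebra all_fingroup.
From mathcomp Require Import finmap ring lra.
From mathcomp Require Import all_classical all_reals all_analysis.
From mathcomp Require Import measurable_realfun.

(** Write [U(x)] for the off-diagonal sum evaluated at an array [x] whose row [j]
    feeds the [j]-th argument. Put [X^0 = X] and [X^1, .., X^k] (the copies) on a
    common space so that all entries are independent.

    If each entry of an array is selected at random, independently over the
    columns [i], among [X^0_i, .., X^k_i], in such a way that for every fixed
    selection [w] the selected array has the law of the copies (resp. of [X] in
    every row), then the conditional mean [M] of [U] over [w] satisfies
    [P(|M| >= t) <= c^-1 P(|U(selected)| >= t)]. Indeed, given the [X^j], [U] is a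
    polynomial of degree at most [k] in the independent letters of [w], so by
    Hahn-Banach and the comparison of its second and fourth moments it exceeds its
    mean in norm with probability at least [c = c(k)].

    Since [U] is multilinear in the laws of the selections, it remains to
    write the quantity of interest as a fixed linear combination of such
    means. For the upper bound, row [j], for [j] in a set [A], takes [X^0_i]
    when the letter [w_i], uniform in [{1, .., k}], equals [j], and [X^j_i]
    otherwise, while rows outside [A] keep [X^j]; the point mass at [0] is
    then [k] times the selection law minus [(k - 1)] times the point mass at
    [j], and no symmetrization or induction on mixed terms is needed. For the
    lower bound, [w_i] is uniform in [A], every row takes [X^(w_i)_i], and the
    polarization identity recovers [k! U(X^1, .., X^k)] when [f] is symmetric. *)

Set Implicit Arguments.
Unset Strict Implicit.
Unset Printing Implicit Defensive.

Import Order.TTheory GRing.Theory Num.Theory.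
Import numFieldNormedType.Exports.

Local Open Scope classical_set_scope.
Local Open Scope ring_scope.

(** * Sublinear functionals *)

Section sublinear_functionals.
Variables (R : realType) (V : lmodType R).
Implicit Types (p : V -> R) (x y : V).

Definition sublinear p : Prop :=
  (forall x y, p (x + y) <= p x + p y) /\
  (forall (t : R) x, 0 <= t -> p (t *: x) = t * p x).

(* For sublinear [p], the largest sublinear [q <= p] with [q (- y) <= - p y]. *)
Definition flatten_along p y x : R :=
  inf [set p (x + t *: y) - t * p y | t in [set t : R | 0 <= t]].

Lemma sublinear0 p : sublinear p -> p 0 = 0.
Proof. by move=> [_ ph]; have := ph 0 0 (lexx 0); rewrite scale0r mul0r. Qed.

Lemma flatten_along_le p y x t : sublinear p -> 0 <= t ->
  flatten_along p y x <= p (x + t *: y) - t * p y.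
Proof.
move=> [psub ph] t0; apply: ge_inf; last by exists t.
(* The set is bounded below by [- p (- x)], since [s * p y = p (s *: y) <= p (x + s *: y) + p (-
   x)]; so its [inf] is a genuine infimum. *)
exists (- p (- x)) => _ [s s0 <-].
rewrite -ph// lerBrDr addrC lerBlDr.
by apply: le_trans (psub _ _); rewrite addrAC subrr add0r.
Qed.

Lemma le_flatten_along p y x a :
  (forall t, 0 <= t -> a <= p (x + t *: y) - t * p y) ->
  a <= flatten_along p y x.
Proof.
move=> h; apply: lb_le_inf; first by exists (p (x + 0 *: y) - 0 * p y), 0 => //=.
by move=> _ [t t0 <-]; apply: h.
Qed.

Lemma sublinear_flatten_along p y : sublinear p -> sublinear (flatten_along p y).
Proof.
move=> sp; have [psub ph] := sp.
have qD x z : flatten_along p y (x + z) <= flatten_along p y x + flatten_along p y z.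
  rewrite -lerBlDr; apply: le_flatten_along => t t0.
  rewrite lerBlDr -lerBlDl; apply: le_flatten_along => s s0.
  rewrite lerBlDl; apply: le_trans (flatten_along_le _ _ sp (addr_ge0 s0 t0)) _.
  have := psub (x + t *: y) (z + s *: y).
  rewrite addrACA -scalerDl (addrC t s); lra.
have qZ (t : R) x : 0 < t -> flatten_along p y (t *: x) <= t * flatten_along p y x.
  move=> t0; rewrite mulrC -ler_pdivrMr//; apply: le_flatten_along => s s0.
  rewrite ler_pdivrMr//.
  apply: le_trans (flatten_along_le _ _ sp (mulr_ge0 (ltW t0) s0)) _.
  by rewrite -scalerA -scalerDr ph ?(ltW t0)//; lra.
split=> // t x; rewrite le_eqVlt => /predU1P[<-|t0].
  rewrite scale0r mul0r; apply/eqP; rewrite eq_le; apply/andP; split.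
    have := flatten_along_le y 0 sp (lexx 0).
    by rewrite scale0r mul0r addr0 subr0 (sublinear0 sp).
  by apply: le_flatten_along => s s0; rewrite add0r ph// subrr.
apply/eqP; rewrite eq_le qZ//= mulrC -ler_pdivlMr// mulrC.
(* The reverse inequality is [qZ] for the scalar [t^-1] at [t *: x]. *)
have := qZ t^-1 (t *: x); rewrite invr_gt0 => /(_ t0).
by rewrite scalerA mulVf ?gt_eqF// scale1r.
Qed.

Lemma flatten_along_self p y x : sublinear p -> flatten_along p y x <= p x.
Proof.
by move=> sp; have := flatten_along_le y x sp (lexx 0); rewrite scale0r mul0r addr0 subr0.
Qed.

Lemma flatten_along_opp p y : sublinear p -> flatten_along p y (- y) <= - p y.
Proof.
move=> sp; have := flatten_along_le y (- y) sp ler01.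
by rewrite scale1r mul1r addNr (sublinear0 sp) sub0r.
Qed.

Lemma sublinear_ge p x : sublinear p -> - p (- x) <= p x.
Proof.
move=> sp; have [psub _] := sp; have := psub x (- x).
by rewrite subrr (sublinear0 sp); lra.
Qed.

(** Subadditivity gives [p x <= p (x + y) + p (- y)], so flatness along [y] turns the inequality for
    [p (x + y)] into an equality. *)
Lemma sublinear_additive p y : sublinear p -> p (- y) <= - p y ->
  forall x, p (x + y) = p x + p y.
Proof.
move=> sp pNy x; have [psub _] := sp; apply/eqP; rewrite eq_le psub/=.
by have := psub (x + y) (- y); rewrite addrK; lra.
Qed.

(* Hahn-Banach for finitely many vectors: flattening along each of them in turn
   avoids Zorn's lemma. *)
Lemma sublinear_minorant p (s : seq V) : sublinear p ->
  exists q, [/\ sublinear q, forall x, q x <= p x &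
                forall y, y \in s -> q (- y) <= - q y].
Proof.
elim: s p => [|y s IHs] p sp; first by exists p; split.
have [q [sq qp qs]] := IHs _ (sublinear_flatten_along y sp).
exists q; split=> // [x|z].
  exact: le_trans (qp x) (flatten_along_self _ _ sp).
rewrite inE => /predU1P[->|/qs//].
(* The chain is [q (- y) <= flatten_along p y (- y) <= - p y <= - flatten_along p y y <= - q y]. *)
have := qp (- y); have := flatten_along_opp y sp.
by have := qp y; have := flatten_along_self y y sp; lra.
Qed.

End sublinear_functionals.

(** Flattening the norm along [v] first forces [p (- v) <= - |v|], hence [p v = |v|]. Additivity in
    the directions of [s] stands in for linearity: [p] is only evaluated at finite sums of vectors
    of [s]. *)
Lemma norming_functional (R : realType) (B : normedModType R) (v : B) (s : seq B) :
  exists p : B -> R, [/\ p 0 = 0, p v = `|v|, forall x, p x <= `|x| &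
    forall y, y \in s -> forall x, p (x + y) = p x + p y].
Proof.
have sn : sublinear (fun x : B => `|x|).
  split=> [x y|t x t0]; first exact: ler_normD.
  by rewrite normrZ ger0_norm.
have [p [sp pn ps]] := sublinear_minorant s (sublinear_flatten_along v sn).
exists p; split.
- exact: sublinear0.
- have := sublinear_ge v sp; have := pn (- v); have := pn v.
  by have := flatten_along_self v v sn; have := flatten_along_opp v sn => /=; lra.
- by move=> x; apply: le_trans (pn x) (flatten_along_self _ _ sn).
- by move=> y /ps; apply: sublinear_additive.
Qed.

(** * Polynomials in uniform letters *)

Section word_average.
Variables (R : realType) (K : finType).
Hypothesis K0 : (0 < #|K|)%N.
Implicit Types (f g h : seq K -> R) (F G : K -> R) (n D : nat).

Definition avg F : R := #|K|%:R^-1 * \sum_c F c.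

(** Expectation over a uniform word of length [n]. The recursion on the first letter suits induction
    on the length; [mean_tuple] gives the closed form. *)
Fixpoint mean n h : R :=
  if n is n'.+1 then avg (fun c => mean n' (fun w => h (c :: w))) else h [::].

Let K0R : 0 < #|K|%:R :> R. Proof. by rewrite ltr0n. Qed.

Lemma avgD F G : avg (fun c => F c + G c) = avg F + avg G.
Proof. by rewrite /avg big_split mulrDr. Qed.

Lemma avgZ a F : avg (fun c => a * F c) = a * avg F.
Proof. by rewrite /avg -mulr_sumr mulrCA. Qed.

Lemma avg_cst a : avg (fun=> a) = a.
Proof. by rewrite /avg sumr_const -[a *+ _]mulr_natl mulKf ?gt_eqF. Qed.

Lemma ler_avg F G : (forall c, F c <= G c) -> avg F <= avg G.
Proof. by move=> FG; rewrite ler_pM2l ?invr_gt0// ler_sum. Qed.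

(** For nonnegative terms the sum of squares is at most the square of the sum; normalizing both
    costs the factor [#|K|]. *)
Lemma avg_sqr_le F : (forall c, 0 <= F c) ->
  avg (fun c => F c ^+ 2) <= #|K|%:R * avg F ^+ 2.
Proof.
move=> F0; rewrite /avg exprMn [leRHS]mulrA exprVn expr2 invfM mulVKf ?gt_eqF//.
rewrite ler_pM2l ?invr_gt0// expr2 mulr_suml ler_sum// => c _.
by rewrite expr2 ler_wpM2l// (bigD1 c)//= lerDl sumr_ge0.
Qed.

Lemma eq_mean n f g : (forall w, size w = n -> f w = g w) -> mean n f = mean n g.
Proof.
elim: n f g => [|n IHn] f g fg /=; first exact: fg.
by congr (_ * _); apply: eq_bigr => c _; apply: IHn => w sw; apply: fg => /=; rewrite sw.
Qed.

Lemma ler_mean n f g : (forall w, size w = n -> f w <= g w) -> mean n f <= mean n g.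
Proof.
elim: n f g => [|n IHn] f g fg /=; first exact: fg.
by apply: ler_avg => c; apply: IHn => w sw; apply: fg => /=; rewrite sw.
Qed.

Lemma meanD n f g : mean n (fun w => f w + g w) = mean n f + mean n g.
Proof.
elim: n f g => [//|n IHn] f g /=; rewrite -avgD.
by congr (_ * _); apply: eq_bigr => c _; exact: IHn.
Qed.

Lemma meanZ n a f : mean n (fun w => a * f w) = a * mean n f.
Proof.
elim: n f => [//|n IHn] f /=; rewrite -avgZ.
by congr (_ * _); apply: eq_bigr => c _; exact: IHn.
Qed.

Lemma mean_cst n a : mean n (fun=> a) = a.
Proof. by elim: n => [//|n IHn] /=; under eq_fun do rewrite IHn; exact: avg_cst. Qed.

Lemma mean_ge0 n f : (forall w, size w = n -> 0 <= f w) -> 0 <= mean n f.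
Proof. by move=> f0; rewrite -[leLHS](mean_cst n); apply: ler_mean. Qed.

Lemma mean_avg n (F : K -> seq K -> R) :
  mean n (fun w => avg (F^~ w)) = avg (fun c => mean n (F c)).
Proof.
elim: n F => [//|n IHn] F /=; under eq_fun do rewrite IHn.
by rewrite /avg -!mulr_sumr exchange_big.
Qed.

Lemma mean_tuple n h :
  mean n h = #|K|%:R^-1 ^+ n * \sum_(w : n.-tuple K) h w.
Proof.
elim: n h => [|n IHn] h /=.
  rewrite expr0 mul1r (big_pred1 [tuple])//= => w.
  by rewrite [w]tuple0; apply/esym/eqP.
rewrite /avg exprS -mulrA; congr (_ * _).
rewrite (eq_bigr _ (fun c _ => IHn (fun w => h (c :: w)))).
rewrite -mulr_sumr; congr (_ * _).
rewrite pair_big /= (reindex (fun p : K * n.-tuple K => [tuple of p.1 :: p.2]))//=.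
exists (fun w => (thead w, [tuple of behead w])) => [[c w] _|w _] /=.
  by congr (_, _); apply/val_inj.
by rewrite -tuple_eta.
Qed.

Lemma mean_eq0 n f : (forall w, 0 <= f w) -> mean n f = 0 ->
  forall w, size w = n -> f w = 0.
Proof.
move=> f0 /eqP; rewrite mean_tuple mulf_eq0 expf_eq0 invr_eq0 (gt_eqF K0R) andbF/=.
rewrite psumr_eq0// => /allP fw w /eqP sw.
by have /eqP := fw (Tuple sw) (mem_index_enum _).
Qed.

(** The mean of [(f - l g)^2] is a nonnegative quadratic in [l]; it is evaluated at its minimizer
    [c / b]. *)
Lemma mean_CauchySchwarz n f g :
  mean n (fun w => f w * g w) ^+ 2 <=
  mean n (fun w => f w ^+ 2) * mean n (fun w => g w ^+ 2).
Proof.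
set a := mean n (fun w => f w ^+ 2); set b := mean n (fun w => g w ^+ 2).
set c := mean n (fun w => f w * g w).
have q (l : R) : 0 <= a + l * (- 2 * c) + l ^+ 2 * b.
  rewrite -!meanZ -!meanD; apply: mean_ge0 => w _.
  by rewrite (_ : _ + _ = (f w - l * g w) ^+ 2) ?sqr_ge0//; ring.
have b0 : 0 <= b by apply: mean_ge0 => w _; rewrite sqr_ge0.
move: b0; rewrite le_eqVlt => /predU1P[b0|b0].
  have [->|c0] := eqVneq c 0; first by rewrite -b0 mulr0 expr0n.
  (* With [b = 0] the quadratic is affine of slope [- 2 c], and this [l] would give it the value
     [-1]. *)
  have := q ((a + 1) / (2 * c)); rewrite -b0 mulr0 addr0 (_ : _ + _ = - 1).
    by rewrite lerNr oppr0 ler10.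
  by field.
have := q (c / b); rewrite -(pmulr_rge0 _ b0).
rewrite (_ : b * _ = a * b - c ^+ 2) ?subr_ge0//.
by field; rewrite gt_eqF.
Qed.

(* [lowdeg D n f]: on words of length [n], [f] is a polynomial of degree less
   than [D] in the letters; passing from one letter to another lowers the degree. *)
Fixpoint lowdeg D n f : Prop :=
  match D, n with
  | 0%N, _ => forall w, size w = n -> f w = 0
  | _.+1, 0%N => True
  | D'.+1, n'.+1 => (forall c, lowdeg D n' (fun w => f (c :: w))) /\
      (forall c d, lowdeg D' n' (fun w => f (c :: w) - f (d :: w)))
  end.

Lemma eq_lowdeg D n f g : (forall w, size w = n -> f w = g w) ->
  lowdeg D n f -> lowdeg D n g.
Proof.
elim: n D f g => [|n IHn] [|D] f g fg //=; try by move=> h w sw; rewrite -fg// h.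
move=> [h1 h2]; split=> [c|c d].
  by apply: IHn (h1 c) => w sw; apply: fg => /=; rewrite sw.
by apply: IHn (h2 c d) => w sw; rewrite !fg//= sw.
Qed.

Lemma lowdeg0 D n f : (forall w, size w = n -> f w = 0) -> lowdeg D n f.
Proof.
elim: n D f => [|n IHn] [|D] f f0 //=; split=> [c|c d]; apply: IHn => w sw.
  by apply: f0; rewrite /= sw.
by rewrite !f0 ?subrr//= sw.
Qed.

Lemma lowdegD D n f g : lowdeg D n f -> lowdeg D n g ->
  lowdeg D n (fun w => f w + g w).
Proof.
elim: n D f g => [|n IHn] [|D] f g //=; try by move=> f0 g0 w sw; rewrite f0// g0// addr0.
move=> [f1 f2] [g1 g2]; split=> [c|c d]; first exact: IHn.
by apply: eq_lowdeg (IHn _ _ _ (f2 c d) (g2 c d)) => w _; ring.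
Qed.

Lemma lowdegZ D n a f : lowdeg D n f -> lowdeg D n (fun w => a * f w).
Proof.
elim: n D f => [|n IHn] [|D] f //=; try by move=> f0 w sw; rewrite f0// mulr0.
move=> [f1 f2]; split=> [c|c d]; first exact: IHn.
by apply: eq_lowdeg (IHn _ _ (f2 c d)) => w _; ring.
Qed.

Lemma lowdeg_sum D n (J : Type) (r : seq J) (F : J -> seq K -> R) :
  (forall j, lowdeg D n (F j)) -> lowdeg D n (fun w => \sum_(j <- r) F j w).
Proof.
move=> FD; elim: r => [|j r IHr].
  by apply: lowdeg0 => w _; rewrite big_nil.
by apply: eq_lowdeg (lowdegD (FD j) IHr) => w _; rewrite big_cons.
Qed.

Lemma lowdeg_avg D n (F : K -> seq K -> R) :
  (forall c, lowdeg D n (F c)) -> lowdeg D n (fun w => avg (F^~ w)).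
Proof. by move=> FD; apply/lowdegZ/lowdeg_sum. Qed.

Lemma lowdeg_cst D n a : lowdeg D.+1 n (fun=> a).
Proof.
elim: n D => [//|n IHn] D; split=> [c|c d]; first exact: IHn.
by apply: lowdeg0 => w _; rewrite subrr.
Qed.

(** A function of fewer than [D] letters has degree less than [D]: changing the first letter either
    leaves it unchanged, so the difference vanishes, or leaves one relevant position fewer. *)
Lemma lowdeg_junta (c0 : K) D n (J : pred nat) f :
  (count J (iota 0 n) < D)%N ->
  (forall w w', size w = n -> size w' = n ->
     (forall i, (i < n)%N -> J i -> nth c0 w i = nth c0 w' i) -> f w = f w') ->
  lowdeg D n f.
Proof.
elim: n D J f => [|n IHn] [|D] J f //=.
have -> : iota 1 n = map S (iota 0 n) by rewrite -(iotaDl 1 0).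
rewrite count_map => JD fJ.
have JS c : forall w w', size w = n -> size w' = n ->
   (forall i, (i < n)%N -> preim S J i -> nth c0 w i = nth c0 w' i) ->
   f (c :: w) = f (c :: w').
  move=> w w' sw sw' ww'; apply: fJ; rewrite /= ?sw ?sw'// => -[|i]//=.
  by rewrite ltnS => /ww'.
split=> [c|c d].
  by apply: (IHn _ (preim S J)); [exact: leq_ltn_trans (leq_addl _ _) JD|exact: JS].
case J0 : (J 0%N) JD => /= JD; last first.
  apply: lowdeg0 => w sw; apply/eqP; rewrite subr_eq0; apply/eqP.
  by apply: fJ; rewrite /= ?sw// => -[|i]//; rewrite J0.
apply: (IHn _ (preim S J)) => // w w' sw sw' ww'.
by rewrite (JS c _ _ sw sw' ww') (JS d _ _ sw sw' ww').
Qed.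

(** The term [4 a b^3] is absorbed by [2 a^2 b^2 + 2 b^4]. The remaining odd term [4 a^3 b] will
    average to zero. *)
Lemma fourth_power_le (a b : R) :
  (a + b) ^+ 4 <= a ^+ 4 + 4 * (a ^+ 3 * b) + 8 * (a ^+ 2 * b ^+ 2) + 3 * b ^+ 4.
Proof.
rewrite -subr_ge0 (_ : _ - _ = 2 * ((a * b - b ^+ 2) ^+ 2)); first by rewrite mulr_ge0 ?sqr_ge0.
ring.
Qed.

(* The fourth-moment case of Bonami's hypercontractivity: split [f] into its
   average over the first letter and a centred part of smaller degree. *)
Lemma fourth_moment (m C : R) D n f : 0 <= m -> #|K|%:R <= m -> 16 + 3 * m <= C ->
  lowdeg D n f ->
  mean n (fun w => f w ^+ 4) <= C ^+ D * mean n (fun w => f w ^+ 2) ^+ 2.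
Proof.
move=> m0 Km mC; have C1 : 1 <= C by lra.
have C0 : 0 <= C by lra.
elim: n D f => [|n IHn] [|D] f /=.
- by move=> f0; rewrite f0// -!exprM !expr0n mulr0.
- by move=> _; rewrite -exprM ler_peMl ?exprn_even_ge0// exprn_ege1.
- move=> f0; rewrite expr0 mul1r (_ : avg _ = 0) ?sqr_ge0// -[RHS](avg_cst 0).
  congr (_ * _); apply: eq_bigr => c _; rewrite -[RHS](mean_cst n).
  by apply: eq_mean => w sw; rewrite f0 ?expr0n//= sw.
move=> [f1 f2].
pose a w := avg (fun c => f (c :: w)).
pose b c w := f (c :: w) - a w.
have fE c w : f (c :: w) = a w + b c w by rewrite /b addrC subrK.
have ba w : avg (b^~ w) = 0.
  rewrite /b -[X in avg X]/(fun c => f (c :: w) + (- a w)).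
  by rewrite avgD avg_cst subrr.
have aD : lowdeg D.+1 n a by apply: lowdeg_avg.
(* [b c] is the average over [d] of the differences [f (c :: w) - f (d :: w)], each of smaller
   degree. *)
have bD c : lowdeg D n (b c).
  apply: eq_lowdeg (lowdeg_avg (f2 c)) => w _.
  rewrite /b /a -[X in avg X]/(fun d => f (c :: w) + (- f (d :: w))) avgD avg_cst.
  congr (_ + _); rewrite -mulN1r -avgZ; congr (_ * _); apply: eq_bigr => d _.
  by rewrite mulN1r.
have {}IHa := IHn _ _ aD.
have IHb c := IHn _ _ (bD c).
set A := mean n (fun w => a w ^+ 2) in IHa.
pose q c := mean n (fun w => b c w ^+ 2).
have A0 : 0 <= A by apply: mean_ge0 => w _; rewrite sqr_ge0.
have q0 c : 0 <= q c by apply: mean_ge0 => w _; rewrite sqr_ge0.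
have f2E : avg (fun c => mean n (fun w => f (c :: w) ^+ 2)) = A + avg q.
  transitivity (avg (fun c => A + (2 * mean n (fun w => a w * b c w) + q c))).
    congr (_ * _); apply: eq_bigr => c _; rewrite -meanZ -!meanD.
    by apply: eq_mean => w _; rewrite fE; ring.
  rewrite !avgD avg_cst avgZ -mean_avg (_ : mean n _ = 0) ?mulr0 ?add0r//.
  rewrite -[RHS](mean_cst n); apply: eq_mean => w _.
  by rewrite avgZ ba mulr0.
(* Cauchy-Schwarz and the two induction hypotheses bound the square of the left side by
   [16 C^(2D+1) A^2 (q c)^2]; [16 <= C] then supplies the missing power of [C]. *)
have ab c : 4 * mean n (fun w => a w ^+ 2 * b c w ^+ 2) <= C ^+ D.+1 * (A * q c).
  have r0 : 0 <= C ^+ D.+1 * (A * q c) by rewrite !mulr_ge0 ?exprn_ge0.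
  rewrite -(@ler_pXn2r _ 2) ?nnegrE//; last first.
    by rewrite mulr_ge0// mean_ge0// => w _; rewrite mulr_ge0 ?sqr_ge0.
  rewrite exprMn; apply: (@le_trans _ _ (4 ^+ 2 * (C ^+ D.+1 * A ^+ 2 * (C ^+ D * q c ^+ 2)))).
    rewrite ler_wpM2l ?sqr_ge0//; apply: le_trans (mean_CauchySchwarz _ _ _) _.
    apply: ler_pM; rewrite ?mean_ge0//; try by move=> w _; rewrite sqr_ge0.
      by under eq_fun do rewrite -exprM.
    by under eq_fun do rewrite -exprM.
  rewrite (_ : 4 ^+ 2 * _ = 16 * (C ^+ D.+1 * A ^+ 2 * (C ^+ D * q c ^+ 2))); last by ring.
  rewrite [leRHS](_ : _ = C * (C ^+ D.+1 * A ^+ 2 * (C ^+ D * q c ^+ 2)));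
    last by rewrite !exprS; ring.
  by rewrite ler_wpM2r ?mulr_ge0 ?exprn_ge0//; lra.
have qQ : avg (fun c => q c ^+ 2) <= m * avg q ^+ 2.
  by apply: le_trans (avg_sqr_le q0) _; rewrite ler_wpM2r ?sqr_ge0.
have Q0 : 0 <= avg q by rewrite -[leLHS](avg_cst 0) ler_avg.
rewrite f2E; apply: (@le_trans _ _ (avg (fun c =>
   C ^+ D.+1 * A ^+ 2 + (4 * mean n (fun w => a w ^+ 3 * b c w) +
   (2 * (C ^+ D.+1 * A) * q c + 3 * C ^+ D * q c ^+ 2))))).
  apply: ler_avg => c.
  apply: (@le_trans _ _ (mean n (fun w => a w ^+ 4 + 4 * (a w ^+ 3 * b c w) +
     8 * (a w ^+ 2 * b c w ^+ 2) + 3 * b c w ^+ 4))).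
    by apply: ler_mean => w _; rewrite fE fourth_power_le.
  rewrite !meanD !meanZ; have := ab c; have := IHb c; rewrite -/(q c); lra.
rewrite !avgD avg_cst !avgZ -mean_avg (_ : mean n _ = 0); last first.
  rewrite -[RHS](mean_cst n); apply: eq_mean => w _.
  by rewrite avgZ ba mulr0.
have CD0 : 0 <= C ^+ D by rewrite exprn_ge0.
(* Here [3 m <= C] is used. The three surviving terms are now bounded by [C^(D+1)] times [A^2],
   [2 A Q] and [Q^2] with [Q = avg q], which add up to [C^(D+1) (A + Q)^2]. *)
have : 3 * C ^+ D * avg (fun c => q c ^+ 2) <= C ^+ D.+1 * avg q ^+ 2.
  apply: (@le_trans _ _ (3 * C ^+ D * (m * avg q ^+ 2))).
    by rewrite ler_wpM2l// mulr_ge0.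
  rewrite (exprS C D) mulrA (_ : _ * m = 3 * m * C ^+ D); last by ring.
  by rewrite ler_wpM2r ?sqr_ge0// ler_wpM2r//; lra.
rewrite sqrrD; lra.
Qed.

End word_average.

(* Averaging this for [y] of mean 0, variance 1 and fourth moment at most [E]
   bounds the probability of [0 <= y] from below by [1 / (4 E^2)]. *)
Lemma quartic_le_indicator (R : realFieldType) (E y : R) : 4 <= E ->
  2 * E ^+ 2 * y + 2 * E * y ^+ 2 - y ^+ 4 <= 4 * E ^+ 3 * (0 <= y)%R%:R.
Proof.
move=> E4; have E0 : 0 <= E by lra.
have [y0|y0] := leP 0 y; rewrite ?mulr1 ?mulr0.
  have [yE|/ltW Ey] := leP y E.
    have h1 : E ^+ 2 * y <= E ^+ 2 * E by rewrite ler_wpM2l ?sqr_ge0.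
    have h2 : E * y ^+ 2 <= E * E ^+ 2 by rewrite ler_wpM2l// lerXn2r ?nnegrE.
    have h3 : 0 <= y ^+ 4 by rewrite exprn_ge0.
    by rewrite exprS; lra.
  have h1 : E ^+ 2 * y <= y ^+ 2 * y by rewrite ler_wpM2r// lerXn2r ?nnegrE.
  have h2 : E * y ^+ 2 <= y * y ^+ 2 by rewrite ler_wpM2r ?sqr_ge0.
  have h3 : 4 * y ^+ 3 <= y * y ^+ 3 by rewrite ler_wpM2r ?exprn_ge0//; lra.
  have h4 : 0 <= E ^+ 3 by rewrite exprn_ge0.
  by move: h1 h2 h3; rewrite -!exprS -exprSr; lra.
(* For negative [y] the bracket below must be nonpositive: [2 E u <= 2 E^2] if [u <= E], and
   [2 E u <= 2 u^2 <= u^3] otherwise. *)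
set u := - y; have u0 : 0 <= u by rewrite /u; lra.
have -> : y = - u by rewrite opprK.
rewrite (_ : _ - _ = u * (2 * E * u - 2 * E ^+ 2 - u ^+ 3)); last by ring.
rewrite mulr_ge0_le0//; have u3 : 0 <= u ^+ 3 by rewrite exprn_ge0.
have [uE|/ltW Eu] := leP u E.
  have : E * u <= E * E by rewrite ler_wpM2l.
  by rewrite -expr2; lra.
have h1 : E * u <= u * u by rewrite ler_wpM2r.
have h2 : 4 * u ^+ 2 <= u * u ^+ 2 by rewrite ler_wpM2r ?exprn_ge0//; lra.
have h4 : 0 <= u ^+ 2 by rewrite exprn_ge0.
have h5 : 0 <= E ^+ 2 by rewrite exprn_ge0.
by move: h1 h2; rewrite -expr2 -exprS; lra.
Qed.

(** Normalize [f - mean n f] to [y] of variance 1; its fourth moment is at most [E]. Averaging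
    [quartic_le_indicator] gives [2 E - E <= 4 E^3 p], where [p] is the mean to be bounded below. *)
Lemma anticoncentration (R : realType) (K : finType) (m : R) D n (f : seq K -> R) :
  (0 < #|K|)%N -> #|K|%:R <= m -> lowdeg D.+1 n f ->
  (4 * ((16 + 3 * m) ^+ D.+1) ^+ 2)^-1 <=
  mean n (fun w => (mean n f <= f w)%R%:R : R).
Proof.
move=> K0 Km fD; have m0 : 0 <= m by apply: le_trans Km; rewrite ler0n.
set C := 16 + 3 * m; set E := C ^+ D.+1.
have C1 : 1 <= C by rewrite /C; lra.
have E16 : 16 <= E.
  by rewrite /E exprS; have := exprn_ege1 D C1; rewrite /C in C1 *; nra.
pose Y w := f w + - mean n f.
have YD : lowdeg D.+1 n Y by apply: lowdegD => //; exact: lowdeg_cst.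
have Y0 : mean n Y = 0 by rewrite meanD mean_cst// subrr.
have YE w : (mean n f <= f w) = (0 <= Y w) by rewrite subr_ge0.
under eq_fun do rewrite YE.
have E0 : 0 < 4 * E ^+ 2 by rewrite mulr_gt0// exprn_gt0//; lra.
set M := mean n (fun w => Y w ^+ 2).
have M0 : 0 <= M by apply: mean_ge0 => // w _; rewrite sqr_ge0.
(* With zero variance [f] is constant on words of length [n], so the indicator is always 1. *)
move: M0; rewrite le_eqVlt => /predU1P[M0|M0].
  apply: (@le_trans _ _ 1).
    by rewrite invf_le1// -[leLHS]mulr1; apply: ler_pM => //; rewrite ?expr_ge1//; lra.
  rewrite -[leLHS](mean_cst K0 n); apply: ler_mean => // w sw.
  have := mean_eq0 K0 (fun w => sqr_ge0 (Y w)) (esym M0) sw.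
  by move=> /eqP; rewrite sqrf_eq0 => /eqP ->; rewrite lexx.
set s := Num.sqrt M; have s0 : 0 < s by rewrite sqrtr_gt0.
have sM : s ^+ 2 = M by rewrite sqr_sqrtr// ltW.
pose y w := s^-1 * Y w.
have yE w : (0 <= Y w) = (0 <= y w) by rewrite pmulr_rge0// invr_gt0.
under eq_fun do rewrite yE.
have y1 : mean n y = 0 by rewrite meanZ Y0 mulr0.
have y2 : mean n (fun w => y w ^+ 2) = 1.
  by under eq_fun do rewrite exprMn; rewrite meanZ exprVn sM mulVf ?gt_eqF.
have y4 : mean n (fun w => y w ^+ 4) <= E.
  rewrite -[E]mulr1 -[X in _ * X](expr1n _ 2) -y2.
  by apply: (fourth_moment K0 m0 Km (lexx C)); apply: lowdegZ.
clearbody y.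
have : mean n (fun w => 2 * E ^+ 2 * y w + 2 * E * y w ^+ 2 + -1 * y w ^+ 4) <=
    4 * E ^+ 3 * mean n (fun w => (0 <= y w)%R%:R : R).
  rewrite -meanZ; apply: ler_mean => // w _; rewrite mulN1r.
  by apply: quartic_le_indicator; lra.
rewrite !meanD !meanZ y1 y2 mulN1r => h.
rewrite -(ler_pM2l E0) divff ?gt_eqF// -(@ler_pM2l _ E); last by lra.
have -> : E * (4 * E ^+ 2 * mean n (fun w => (0 <= y w)%R%:R : R)) =
  4 * E ^+ 3 * mean n (fun w => (0 <= y w)%R%:R : R) by ring.
lra.
Qed.

(** A functional [p] norming the mean of [h] reduces this to a real polynomial: [p (h w)] has mean
    equal to the norm of the mean of [h], and [p (h w) <= |h w|]. Each [g j] reads only the at most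
    [D] positions in [supp j], which bounds the degree. *)
Lemma anticoncentration_norm (R : realType) (B : normedModType R) (K : finType)
    (c0 : K) (m : R) D n (J : finType) (j0 : pred J) (g : J -> seq K -> B)
    (supp : J -> pred nat) (h := fun w => \sum_(j | j0 j) g j w) :
  #|K|%:R <= m ->
  (forall j, j0 j -> (count (supp j) (iota 0 n) <= D)%N) ->
  (forall j w w', j0 j -> size w = n -> size w' = n ->
     (forall i, (i < n)%N -> supp j i -> nth c0 w i = nth c0 w' i) ->
     g j w = g j w') ->
  (4 * ((16 + 3 * m) ^+ D.+1) ^+ 2)^-1 <=
  mean n (fun w => (`|#|K|%:R^-1 ^+ n *: \sum_(v : n.-tuple K) h v| <= `|h w|)%R%:R : R).
Proof.
move=> Km suppD gsupp.
have K0 : (0 < #|K|)%N by apply/card_gt0P; exists c0.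
set v := \sum_(v : n.-tuple K) h v.
pose s := map (fun p : J * n.-tuple K => g p.1 p.2) (enum {: J * n.-tuple K}).
have [p [p0 pv pn padd]] := norming_functional v s.
have gs j (w : n.-tuple K) : g j w \in s.
  by apply/mapP; exists (j, w); rewrite ?mem_enum.
have psum (w : n.-tuple K) x :
    p (x + h w) = p x + \sum_(j | j0 j) p (g j w).
  rewrite /h; elim/big_rec2: _ x => [|j y1 y2 _ IH] x; first by rewrite !addr0.
  by rewrite addrA IH padd// addrA.
have ph (w : n.-tuple K) : p (h w) = \sum_(j | j0 j) p (g j w).
  by rewrite -[h w]add0r psum p0 add0r.
pose f w := \sum_(j | j0 j) p (g j w).
have fD : lowdeg D.+1 n f.
  apply: (@eq_lowdeg _ _ _ _ (fun w => \sum_j (if j0 j then p (g j w) else 0))).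
    by move=> w _; rewrite -big_mkcond.
  apply: lowdeg_sum => j; case: (boolP (j0 j)) => jj; last exact: lowdeg0.
  apply: (@lowdeg_junta _ _ c0 _ _ (supp j)); first by rewrite ltnS suppD.
  by move=> w w' sw sw' ww'; rewrite (gsupp j w w').
have -> : `|#|K|%:R^-1 ^+ n *: v| = mean n f.
  rewrite normrZ ger0_norm ?exprn_ge0// -pv mean_tuple//; congr (_ * _).
  have psumw (r : seq (n.-tuple K)) x :
      p (x + \sum_(v <- r) h v) = p x + \sum_(v <- r) f v.
    elim: r x => [|w r IHr] x; first by rewrite !big_nil !addr0.
    by rewrite !big_cons addrA IHr psum addrA.
  by rewrite /v -[X in p X]add0r psumw p0 add0r.
apply: le_trans (anticoncentration K0 Km fD) _.
apply: ler_mean => // w sw; rewrite ler_nat.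
have -> : f w = p (h w) by rewrite (ph (Tuple (introT eqP sw))).
by case: (leP (mean n f) (p (h w))) => // fp; rewrite (le_trans fp (pn _)).
Qed.

(** * Strongly measurable maps *)

Lemma countable_bigcup_measurable d (T : sigmaRingType d) U (D : set U)
    (F : U -> set T) : countable D ->
  (forall i, D i -> measurable (F i)) -> measurable (\bigcup_(i in D) F i).
Proof.
move=> cD mF; rewrite bigcup_set_type; apply: countable_bigcupT_measurable.
  by rewrite (eq_countable (card_setT _)).
by move=> i; apply: mF; exact: set_valP.
Qed.

Section strongly_measurable.
Context d (T : measurableType d) (R : realType) (B : completeNormedModType R).
Implicit Types f g : T -> B.

Lemma strongly_measurable_open f U : strongly_measurable f -> open U ->
  measurable (f @^-1` U).
Proof.
move=> [mf _] oU; rewrite -[X in measurable X]setTI; apply: mf => //.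
exact: sub_sigma_algebra.
Qed.

Lemma strongly_measurable_comp d' (T' : measurableType d') f (g : T' -> T) :
  strongly_measurable f -> measurable_fun setT g -> strongly_measurable (f \o g).
Proof.
move=> [mf [D cD fD]] mg; split; first exact: measurableT_comp mf mg.
by exists D => // _ [x _ <-]; apply: fD; exists (g x).
Qed.

Lemma measurable_fun_open (f : T -> B) : (forall U, open U -> measurable (f @^-1` U)) ->
  measurable_fun setT (f : T -> g_sigma_algebraType (@open B)).
Proof.
move=> fU; apply: (@measurability _ _ T (g_sigma_algebraType (@open B)) setT f (@open B)) => //.
by move=> _ [U oU <-]; rewrite setTI; exact: fU.
Qed.

Lemma strongly_measurable_cst (b : B) : strongly_measurable (fun _ : T => b).
Proof.
split; first exact: measurable_cst.
exists [set b]; first exact: countable1.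
by move=> _ [x _ <-]; apply: subset_closure.
Qed.

Lemma strongly_measurableZ (a : R) f : strongly_measurable f ->
  strongly_measurable (fun w => a *: f w).
Proof.
move=> sf; have [_ [D cD fD]] := sf; split.
  apply: measurable_fun_open => U oU.
  rewrite (_ : _ @^-1` _ = f @^-1` ((fun b : B => a *: b) @^-1` U))//.
  apply: strongly_measurable_open => //.
  by move/continuousP: (@scaler_continuous R B a) => /(_ _ oU).
exists [set a *: b | b in D]; first exact: (sub_countable (card_image_le _ _)).
move=> _ [x _ <-].
have : closure D (f x) by apply: fD; exists x.
move=> cDf V /(@scaler_continuous R B a) nV.
by have [y [Dy Vy]] := cDf _ nV; exists (a *: y); split => //; exists y.
Qed.

(** Separable ranges are essential: they allow the preimage of an open set under addition to be
    written as a countable union of intersections of preimages of balls. *)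
Lemma strongly_measurableD f g : strongly_measurable f -> strongly_measurable g ->
  strongly_measurable (fun w => f w + g w).
Proof.
move=> sf sg; have [_ [D cD fD]] := sf; have [_ [E cE gE]] := sg.
have close (A : set B) b (e : R) : closure A b -> 0 < e -> exists2 a, A a & `|b - a| < e.
  move=> cA e0; have [a [Aa ba]] := cA _ (nbhsx_ballx b e e0).
  by exists a => //; move: ba; rewrite -ball_normE.
have clf w : closure D (f w) by apply: fD; exists w.
have clg w : closure E (g w) by apply: gE; exists w.
split; last first.
  exists [set p.1 + p.2 | p in D `*` E].
    by apply: (sub_countable (card_image_le _ _)); apply: countableX.
  move=> _ [w _ <-] V /nbhs_ballP[e /= e0 eV].
  have e20 : 0 < e / 2 by rewrite divr_gt0.
  have [a Da fa] := close _ _ _ (clf w) e20.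
  have [b Eb gb] := close _ _ _ (clg w) e20.
  exists (a + b); split; first by exists (a, b).
  apply: eV; rewrite -ball_normE /= opprD addrACA [ltRHS]splitr.
  by apply: le_lt_trans (ler_normD _ _) _; exact: ltrD.
apply: measurable_fun_open => U oU.
pose G (p : B * B) (n : nat) :=
  [set w | `|p.1 - f w| < n.+1%:R^-1] `&` [set w | `|p.2 - g w| < n.+1%:R^-1].
(* A radius [1 / (n + 1)] is good at [p] when addition maps the product of the two balls around [p]
   into [U]. *)
pose good (p : B * B) (n : nat) := forall y z,
  `|p.1 - y| < n.+1%:R^-1 -> `|p.2 - z| < n.+1%:R^-1 -> U (y + z).
rewrite (_ : _ @^-1` U = \bigcup_(p in D `*` E) \bigcup_(n in good p) G p n).
  apply: countable_bigcup_measurable; first exact: countableX.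
  move=> [a b] _; apply: bigcup_measurable => n _.
  have mball (h : T -> B) c : strongly_measurable h ->
      measurable [set w | `|c - h w| < n.+1%:R^-1].
    move=> sh; have := strongly_measurable_open sh (@ball_open _ _ c n.+1%:R^-1).
    by rewrite -ball_normE.
  by apply: measurableI; exact: mball.
apply/seteqP; split=> [w /= Uw|w [[a b] _ [n gn [/= fw gw]]]]; last exact: gn.
move: oU; rewrite openE => /(_ _ Uw) /nbhs_ballP[e /= e0 eU].
(* Four distances are added below: from [f w] to [a], [a] to [y], [g w] to [b], and [b] to [z]. *)
have e40 : 0 < e / 4 by rewrite divr_gt0.
have [n _ ne] := near_infty_natSinv_lt (PosNum e40).
have {}ne : n.+1%:R^-1 < e / 4 by apply: ne => /=.
have n0 : 0 < n.+1%:R^-1 :> R by rewrite invr_gt0.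
have [a Da fa] := close _ _ _ (clf w) n0.
have [b Eb gb] := close _ _ _ (clg w) n0.
exists (a, b); first by [].
exists n; last by split; rewrite /= distrC.
move=> y z /= ay bz; apply: eU; rewrite -ball_normE /=.
rewrite (_ : _ - _ = (f w - a) + (a - y) + ((g w - b) + (b - z))).
  have e2 : e / 2 = e / 4 + e / 4 by field.
  rewrite [ltRHS]splitr e2; apply: le_lt_trans (ler_normD _ _) _.
  by apply: ltrD; apply: le_lt_trans (ler_normD _ _) _; apply: ltrD; apply: lt_trans ne.
by rewrite !subrKA opprD addrACA.
Qed.

Lemma strongly_measurable_sum (J : Type) (r : seq J) (Q : pred J) (F : J -> T -> B) :
  (forall j, Q j -> strongly_measurable (F j)) ->
  strongly_measurable (fun w => \sum_(j <- r | Q j) F j w).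
Proof.
move=> sF; elim: r => [|j r IHr].
  by under eq_fun do rewrite big_nil; exact: strongly_measurable_cst.
under eq_fun do rewrite big_cons.
by case: (boolP (Q j)) => // Qj; apply: strongly_measurableD => //; exact: sF.
Qed.

Lemma measurable_norm_ge f (t : R) : strongly_measurable f ->
  measurable [set w | (t <= `|f w|)%R].
Proof.
move=> sf; rewrite (_ : [set w | _] = ~` (f @^-1` [set b | `|b| < t])); last first.
  by apply/seteqP; split=> w /=; [move=> tf; apply/negP; rewrite -leNgt|move/negP; rewrite -leNgt].
apply/measurableC/strongly_measurable_open => //.
have /continuousP := @norm_continuous R B.
by move=> /(_ [set x | x < t]) h; apply: h; exact: open_lt.
Qed.

Lemma measurable_eq f g : strongly_measurable f -> strongly_measurable g ->
  measurable [set w | f w = g w].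
Proof.
move=> sf sg.
have sfg : strongly_measurable (fun w => f w + -1 *: g w).
  by apply: strongly_measurableD => //; exact: strongly_measurableZ.
rewrite (_ : [set w | _] = ~` ((fun w => f w + -1 *: g w) @^-1` (~` [set 0]))); last first.
  rewrite preimage_setC setCK; apply/seteqP; split=> w /=; rewrite scaleN1r.
    by move=> ->; rewrite subrr.
  by move=> /eqP; rewrite subr_eq0 => /eqP.
apply: measurableC; apply: (strongly_measurable_open sfg).
by rewrite openC; exact: (accessible_closed_set1 (hausdorff_accessible (@norm_hausdorff _ _))).
Qed.

End strongly_measurable.

(** Integrate the pointwise inequality [c * \1_A <= a * \sum_i \1_(F i)]. This turns a bound on the
    proportion of words, valid at each outcome, into a bound on probabilities. *)
Lemma prob_le_average d (T : measurableType d) (R : realType) (P : probability T R)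
    (I : finType) (A : set T) (F : I -> set T) (a c : R) (p : \bar R) :
  0 <= a -> 0 <= c -> a * #|I|%:R = 1 -> measurable A -> (forall i, measurable (F i)) ->
  (forall w, A w -> c <= a * \sum_i \1_(F i) w) -> (forall i, P (F i) = p) ->
  (c%:E * P A <= p)%E.
Proof.
move=> a0 c0 aI mA mF AF Fp.
have -> : (c%:E * P A = \int[P]_w (c * \1_A w)%:E)%E.
  under eq_integral do rewrite EFinM.
  rewrite ge0_integralZl//; last by apply/measurable_EFinP; exact: measurable_indic.
  by rewrite integral_indic// setIT.
have -> : (p = \int[P]_w (a * \sum_i \1_(F i) w)%:E)%E.
  under eq_integral do rewrite EFinM -sumEFin.
  have mi i : measurable_fun setT (fun w => (\1_(F i) w)%:E : \bar R).
    by apply/measurable_EFinP; exact: measurable_indic.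
  rewrite ge0_integralZl//; last 2 first.
    exact: emeasurable_sum.
    by move=> w _; rewrite sume_ge0.
  rewrite ge0_integral_sum//.
  have intF i : (\int[P]_w (\1_(F i) w)%:E = p)%E.
    by rewrite integral_indic// setIT; exact: Fp.
  rewrite (eq_bigr _ (fun i _ => intF i)).
  have pf : p \is a fin_num.
    have i0 : I.
      have : (0 < #|I|)%N.
        rewrite lt0n; apply: contra_eqN aI => /eqP ->.
        by rewrite mulr0 eq_sym oner_neq0.
      by move=> /card_gt0P/sigW[].
    by rewrite -(Fp i0) fin_num_measure.
  rewrite -(fineK pf) sumEFin -EFinM; congr _%:E.
  by rewrite sumr_const -[X in a * X]mulr_natl mulrA aI mul1r.
apply: ge0_le_integral => //.
- by move=> w _; rewrite lee_fin mulr_ge0.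
- by apply/measurable_EFinP; apply: measurable_funM => //; exact: measurable_indic.
- apply/measurable_EFinP; apply: measurable_funM => //.
  by apply: measurable_sum => i; exact: measurable_indic.
- move=> w _; rewrite lee_fin indicE; case: (boolP (w \in A)) => [/set_mem wA|_].
    by rewrite mulr1; exact: AF.
  by rewrite mulr0 mulr_ge0// sumr_ge0.
Qed.

(** * Arrays of independent variables *)

Definition rectangles (I : finType) (d : measure_display) (S : measurableType d) :
    set (set (I -> S)) :=
  [set E | exists2 A : I -> set S, forall i, measurable (A i) &
           E = [set x | forall i, A i (x i)]].

Definition array (I : finType) (d : measure_display) (S : measurableType d) :=
  g_sigma_algebraType (@rectangles I d S).

(** When each [mu i] has total mass 1, this single equation says both that the entries are
    independent and that entry [i] has law [mu i]. *)
Definition product_law (d d' : measure_display) (T : measurableType d)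
    (S : measurableType d') (R : realType) (P : probability T R) (I : finType)
    (W : I -> T -> S) (mu : I -> set S -> \bar R) : Prop :=
  forall A : I -> set S, (forall i, measurable (A i)) ->
    P [set w | forall i, A i (W i w)] = (\prod_i mu i (A i))%E.

Lemma measurable_forall d (T : measurableType d) (I : finType) (A : I -> set T) :
  (forall i, measurable (A i)) -> measurable [set w | forall i, A i w].
Proof.
move=> mA; rewrite (_ : [set w | _] = \bigcap_(i in [set: I]) A i).
  exact: fin_bigcap_measurable.
by apply/seteqP; split=> w Aw i => //; exact: Aw.
Qed.

Section arrays.
Context (I : finType) (d : measure_display) (S : measurableType d).

Lemma measurable_array d' (T : measurableType d') (W : I -> T -> S) :
  (forall i, measurable_fun setT (W i)) ->
  measurable_fun setT ((fun w i => W i w) : T -> array I S).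
Proof.
move=> mW; apply: (@measurability _ _ T (array I S) setT _ (@rectangles I d S)) => //.
move=> _ [_ [A mA ->] <-]; rewrite setTI.
apply: (measurable_forall (A := fun i => W i @^-1` A i)) => i.
by rewrite -[X in measurable X]setTI; exact: mW.
Qed.

Lemma measurable_eval (i : I) : measurable_fun setT (fun x : array I S => x i).
Proof.
move=> _ A mA; rewrite setTI; apply: sub_sigma_algebra.
exists (fun j => if j == i then A else setT) => [j|]; first by case: ifP.
apply/seteqP; split=> x /=; last by move=> /(_ i); rewrite eqxx.
by move=> xA j; case: eqP => // ->.
Qed.

(** Rectangles are stable under intersection and generate the sigma-algebra of [array], so the two
    pushforward measures agree everywhere once they agree on rectangles. *)
Lemma product_law_unique d1 d2 (T1 : measurableType d1) (T2 : measurableType d2)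
    (R : realType) (P1 : probability T1 R) (P2 : probability T2 R)
    (W1 : I -> T1 -> S) (W2 : I -> T2 -> S) (mu : I -> set S -> \bar R) :
  (forall i, measurable_fun setT (W1 i)) -> (forall i, measurable_fun setT (W2 i)) ->
  product_law P1 W1 mu -> product_law P2 W2 mu ->
  forall E : set (array I S), measurable E ->
  P1 [set w | E (fun i => W1 i w)] = P2 [set w | E (fun i => W2 i w)].
Proof.
move=> mW1 mW2 law1 law2 E mE.
pose f1 := (fun w i => W1 i w) : T1 -> array I S.
pose f2 := (fun w i => W2 i w) : T2 -> array I S.
have mf1 : measurable_fun setT f1 by exact: measurable_array.
have mf2 : measurable_fun setT f2 by exact: measurable_array.
pose Q1 : {measure set (array I S) -> \bar R} :=
  measure_function_pushforward__canonical__measure_function_Measure P1 mf1.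
pose Q2 : {measure set (array I S) -> \bar R} :=
  measure_function_pushforward__canonical__measure_function_Measure P2 mf2.
suff : Q1 E = Q2 E by [].
apply: (@g_sigma_algebra_measure_unique _ R (array I S) (@rectangles I d S) _
  (fun=> setT)) mE.
- by move=> A RA; exact: sub_sigma_algebra.
- by move=> _; exists (fun=> setT) => //; apply/seteqP; split.
- by apply/seteqP; split=> // x _; exists 0%N.
- move=> _ _ [A1 mA1 ->] [A2 mA2 ->].
  exists (fun i => A1 i `&` A2 i) => [i|]; first exact: measurableI.
  by apply/seteqP; split=> x /= => [[h1 h2] i|h]; split=> // i; case: (h i).
- by move=> _ [A mA ->]; rewrite /Q1 /Q2 /= /pushforward [LHS]law1// [RHS]law2.
- by move=> _; rewrite /Q1 /= /pushforward preimage_setT probability_setT ltry.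
Qed.

End arrays.

Lemma product_law_reindex (I J : finType) d d' (T : measurableType d)
    (S : measurableType d') (R : realType) (P : probability T R)
    (W : I -> T -> S) (mu : I -> set S -> \bar R) (phi : J -> I) :
  injective phi -> (forall i, mu i setT = 1%E) ->
  product_law P W mu -> product_law P (fun j => W (phi j)) (fun j => mu (phi j)).
Proof.
move=> phi_inj mu1 law A mA.
(* By injectivity this is [A j] at [phi j]; outside the image of [phi] the condition is vacuous and
   gives the whole space. *)
pose A' i := [set x | forall j, phi j = i -> A j x].
have A'E j : A' (phi j) = A j.
  apply/seteqP; split=> x /= => [|Ax j' /phi_inj ->//]; exact.
have A'T i : i \notin codom phi -> A' i = setT.
  by move=> ic; apply/seteqP; split=> // x _ j ji; case/negP: ic; rewrite -ji codom_f.
have mA' i : measurable (A' i).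
  have [/codomP[j ->]|/A'T ->//] := boolP (i \in codom phi).
  by rewrite A'E.
rewrite (_ : [set w | _] = [set w | forall i, A' i (W i w)]); last first.
  apply/seteqP; split=> w /=; first by move=> h i j <-.
  by move=> h j; apply: h.
rewrite law// (bigID (fun i => i \in codom phi))/= [X in (_ * X)%E]big1 ?mule1.
  have uc : uniq (codom phi) by rewrite map_inj_uniq// enum_uniq.
  rewrite -big_uniq//= big_image/=.
  by apply: eq_bigr => j _; rewrite A'E.
by move=> i /A'T ->; rewrite mu1.
Qed.

Lemma mutually_independent_product_law (d d' : measure_display) (T : measurableType d)
    (E : measurableType d') (R : realType) (P : probability T R) (I : choiceType)
    (J : finType) (X : I -> T -> E) (phi : J -> I) :
  injective phi -> mutually_independent P X ->
  product_law P (fun j => X (phi j)) (fun j A => P (X (phi j) @^-1` A)).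
Proof.
move=> phi_inj indep A mA.
pose A' i := [set x | forall j, phi j = i -> A j x].
have A'E j : A' (phi j) = A j.
  apply/seteqP; split=> x /= => [|Ax j' /phi_inj ->//]; exact.
pose D : {fset I} := [fset i in codom phi]%fset.
have Dphi j : phi j \in D by rewrite !inE codom_f.
have := indep D A'; rewrite (_ : \bigcap_(i in _) _ = [set w | forall j, A j (X (phi j) w)]).
  move=> -> => [|i]; last by rewrite !inE => /codomP[j ->]; rewrite A'E.
  have uc : uniq (codom phi) by rewrite map_inj_uniq// enum_uniq.
  rewrite (perm_big (codom phi))/=; last first.
    by apply: uniq_perm => // i; rewrite !inE.
  by rewrite big_image/=; apply: eq_bigr => j _; rewrite A'E.
apply/seteqP; split=> w /=.
  by move=> h j; have := h (phi j) (Dphi j); rewrite /preimage/= -[A j]A'E.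
by move=> h i _ j ji; rewrite -ji; exact: h.
Qed.

Lemma measurable_seq_eval (d : measure_display) (S : measurableType d) (i : nat) :
  measurable_fun setT (fun x : seq_space S => x i).
Proof.
move=> _ A mA; rewrite setTI; apply: sub_sigma_algebra.
by exists i => //; exists A => //; rewrite setTI.
Qed.

(** Independence is used twice: between rows, as random sequences, through the cylinder events
    [A' j]; then inside each row, which has the law of [X]. *)
Lemma independent_copies_product_law (d d' : measure_display) (T : measurableType d)
    (S : measurableType d') (R : realType) (P : probability T R) (k n : nat)
    (X : nat -> T -> S) (Y : 'I_k -> nat -> T -> S) :
  mutually_independent P X -> independent_copies P X Y ->
  product_law P (fun p : 'I_k * 'I_n => Y p.1 p.2) (fun p A => P (X p.2 @^-1` A)).
Proof.
move=> indX [indY lawY] A mA.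
pose A' j := [set x : seq_space S | forall i : 'I_n, A (j, i) (x i)].
have mA' j : measurable (A' j).
  apply: (measurable_forall
    (A := fun i : 'I_n => (fun x : seq_space S => x i) @^-1` A (j, i))) => i.
  by rewrite -[X in measurable X]setTI; exact: measurable_seq_eval.
have := mutually_independent_product_law (@inj_id 'I_k) indY mA'.
rewrite (_ : [set w | _] = [set w | forall p : 'I_k * 'I_n, A p (Y p.1 p.2 w)]); last first.
  by apply/seteqP; split=> w /= h => [[j i]|j i]; [exact: h|exact: (h (j, i))].
move=> ->; transitivity (\prod_(j < k) \prod_(i < n) P (X i @^-1` A (j, i)))%E; last first.
  by rewrite pair_big/=; apply: eq_bigr => -[j i] _.
apply: eq_bigr => j _; rewrite lawY//.
exact: (mutually_independent_product_law (@ord_inj n) indX (fun i => mA (j, i))).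
Qed.

(* [X] and the copies [Y] need not be independent, so [X] is moved to a separate
   factor of a product space, where it becomes row [0]. *)
Definition adjoin_copy (T S : Type) (k : nat) (X : nat -> T -> S)
    (Y : 'I_k -> nat -> T -> S) (j : 'I_k.+1) (i : nat) (w : T * T) : S :=
  if unlift ord0 j is Some j' then Y j' i w.2 else X i w.1.

Lemma adjoin_copy0 (T S : Type) (k : nat) (X : nat -> T -> S)
    (Y : 'I_k -> nat -> T -> S) i w : adjoin_copy X Y ord0 i w = X i w.1.
Proof. by rewrite /adjoin_copy unlift_none. Qed.

Lemma adjoin_copy_lift (T S : Type) (k : nat) (X : nat -> T -> S)
    (Y : 'I_k -> nat -> T -> S) j i w :
  adjoin_copy X Y (lift ord0 j) i w = Y j i w.2.
Proof. by rewrite /adjoin_copy liftK. Qed.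

Section adjoin_copy.
Context (d d' : measure_display) (T : measurableType d)
    (S : measurableType d') (R : realType) (P : probability T R) (k n : nat)
    (X : nat -> T -> S) (Y : 'I_k -> nat -> T -> S).
Hypotheses (mX : forall i, measurable_fun setT (X i))
  (mY : forall j i, measurable_fun setT (Y j i)).

Lemma measurable_adjoin_copy j i : measurable_fun setT (adjoin_copy X Y j i).
Proof.
rewrite /adjoin_copy; case: (unlift ord0 j) => [j'|].
  exact: (measurableT_comp (mY j' i) measurable_snd).
exact: (measurableT_comp (mX i) measurable_fst).
Qed.

(** Row [0] reads only the first coordinate and the other rows only the second, so a rectangle event
    is itself a product [A1] times [A2]. *)
Lemma adjoin_copy_product_law :
  mutually_independent P X -> independent_copies P X Y ->
  product_law (P \x P)%E
    (fun p : 'I_k.+1 * 'I_n => adjoin_copy X Y p.1 p.2)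
    (fun p A => P (X p.2 @^-1` A)).
Proof.
move=> indX indY A mA.
pose A1 := [set w | forall i : 'I_n, A (ord0, i) (X i w)].
pose A2 := [set w | forall p : 'I_k * 'I_n, A (lift ord0 p.1, p.2) (Y p.1 p.2 w)].
rewrite (_ : [set w | _] = A1 `*` A2); last first.
  apply/seteqP; split=> -[w1 w2] /=.
    move=> h; split=> [i|[j i]].
      by have := h (ord0, i); rewrite adjoin_copy0.
    by have := h (lift ord0 j, i); rewrite adjoin_copy_lift.
  move=> [h1 h2] [j i] /=; have [j' ->|->] := unliftP ord0 j.
    by rewrite adjoin_copy_lift; exact: (h2 (j', i)).
  by rewrite adjoin_copy0; exact: h1.
have mA1 : measurable A1.
  apply: (measurable_forall (A := fun i : 'I_n => X i @^-1` A (ord0, i))) => i.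
  by rewrite -[X in measurable X]setTI; exact: mX.
have mA2 : measurable A2.
  apply: (measurable_forall
    (A := fun p : 'I_k * 'I_n => Y p.1 p.2 @^-1` A (lift ord0 p.1, p.2))) => p.
  by rewrite -[X in measurable X]setTI; exact: mY.
transitivity (P A1 * P A2)%E; first exact: product_measure1E.
transitivity (\prod_(j < k.+1) \prod_(i < n) P (X i @^-1` A (j, i)))%E; last first.
  by rewrite pair_big/=; apply: eq_bigr => -[j i] _.
rewrite big_ord_recl; congr (_ * _)%E.
  exact: (mutually_independent_product_law (@ord_inj n) indX (fun i => mA (ord0, i))).
rewrite [LHS](independent_copies_product_law (n := n) indX indY
  (A := fun p => A (lift ord0 p.1, p.2)))//.
by rewrite pair_big/=; apply: eq_bigr => -[j i] _.
Qed.

End adjoin_copy.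

(** * Expansion identities *)

(** Prescribing the letters at [k] distinct positions leaves the other [n - k] free; the product
    form avoids subtracting exponents. Words are counted as a [family] with one choice on the image
    of [i] and [#|K|] choices elsewhere. *)
Lemma card_tuple_fiber (K : finType) (k n : nat) (i : {ffun 'I_k -> 'I_n})
    (v : {ffun 'I_k -> K}) : injective i ->
  (#|[pred w : n.-tuple K | [ffun j => tnth w (i j)] == v]| * #|K| ^ k = #|K| ^ n)%N.
Proof.
move=> i_inj.
pose F x := [pred c : K | [forall j, (i j == x) ==> (c == v j)]].
pose toffun (w : n.-tuple K) := [ffun x => tnth w x].
have toffunK : cancel toffun (fun g : {ffun 'I_n -> K} => [tuple g x | x < n]).
  by move=> w; apply: eq_from_tnth => x; rewrite tnth_mktuple ffunE.
have -> : #|[pred w : n.-tuple K | [ffun j => tnth w (i j)] == v]| = #|family F|.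
  rewrite -(card_imset _ (can_inj toffunK)); apply: eq_card => g.
  apply/imsetP/familyP => [[w]|gF].
    rewrite inE => /eqP wv -> x; rewrite inE; apply/forallP => j.
    by apply/implyP => /eqP <-; rewrite -wv !ffunE.
  exists [tuple g x | x < n]; last by apply/ffunP => x; rewrite ffunE tnth_mktuple.
  rewrite inE; apply/eqP/ffunP => j; rewrite ffunE tnth_mktuple.
  by have /forallP/(_ j) := gF (i j); rewrite eqxx => /eqP.
have FE x : #|F x| = if x \in codom i then 1%N else #|K|.
  case: ifPn => [/codomP[j ->]|xi].
    rewrite -(card1 (v j)); apply: eq_card => c; rewrite !inE.
    apply/forallP/idP => [/(_ j)|/eqP -> j']; first by rewrite eqxx.
    by apply/implyP => /eqP/i_inj ->.
  apply: eq_card => c; rewrite !inE; apply/forallP => j; apply/implyP => /eqP ij.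
  by rewrite -ij codom_f in xi.
rewrite card_family foldrE big_map big_enum /=.
rewrite (bigID (fun x => x \in codom i))/= big1 ?mul1n => [|x xi]; last by rewrite FE xi.
rewrite (eq_bigr (fun=> #|K|)) => [|x xi]; last by rewrite FE (negbTE xi).
rewrite prod_nat_const -expnD; congr (_ ^ _)%N.
by rewrite addnC -[X in (X + _)%N](card_ord k) -(card_codom i_inj) cardC card_ord.
Qed.

Section identities.
Context (R : numFieldType) (V : lmodType R).

(* Averaging over all words sees the letters at distinct positions as
   independent uniform letters. *)
Lemma average_distinct_letters (K : finType) (k n : nat) (i : {ffun 'I_k -> 'I_n})
    (G : {ffun 'I_k -> K} -> V) : injective i -> (0 < #|K|)%N ->
  #|K|%:R^-1 ^+ n *: \sum_(w : n.-tuple K) G [ffun j => tnth w (i j)] =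
  #|K|%:R^-1 ^+ k *: \sum_v G v.
Proof.
move=> i_inj K0; have K0R : #|K|%:R != 0 :> R by rewrite pnatr_eq0 -lt0n.
rewrite (partition_big (fun w : n.-tuple K => [ffun j => tnth w (i j)]) predT)//=.
rewrite !scaler_sumr; apply: eq_bigr => v _.
rewrite (eq_bigr (fun=> G v)) => [|w /eqP -> //].
rewrite sumr_const -[G v *+ _]scaler_nat scalerA; congr (_ *: _).
have /(congr1 (GRing.natmul (1 : R))) := card_tuple_fiber v i_inj.
rewrite natrM !natrX !exprVn => <-.
rewrite invfM -mulrA mulrCA mulVf ?mulr1//.
apply: contraTneq K0 => N0; rewrite -leqNgt leqn0.
have := card_tuple_fiber v i_inj; move/eqP: N0; rewrite pnatr_eq0 => /eqP ->.
by rewrite mul0n => /esym/eqP; rewrite expn_eq0 => /andP[].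
Qed.

Lemma sum_ffun_sub (I J : finType) (a : pred J) (c0 : {x : J | a x})
    (F : {ffun I -> J} -> V) :
  \sum_(v : {ffun I -> {x : J | a x}}) F [ffun j => val (v j)] =
  \sum_(v : {ffun I -> J} | [forall j, a (v j)]) F v.
Proof.
rewrite [RHS](reindex_onto
  (fun v : {ffun I -> {x : J | a x}} => [ffun j => val (v j)])
  (fun v => [ffun j => insubd c0 (v j)])) /=; last first.
  by move=> v /forallP av; apply/ffunP => j; rewrite !ffunE insubdK//; exact: av.
apply: eq_bigl => v; apply/esym/andP; split.
  apply/forallP => j; rewrite ffunE /=. exact: (valP (v j)).
by apply/eqP/ffunP => j; rewrite !ffunE valKd.
Qed.

Lemma prodr_bool (I : finType) (b : pred I) :
  \prod_j (b j)%:R = [forall j, b j]%:R :> R.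
Proof.
have [/forallP bT|/forallPn[j bj]] := boolP [forall j, b j].
  by rewrite big1// => j _; rewrite bT.
by rewrite (bigD1 j)//= (negbTE bj) mul0r.
Qed.

Lemma sum_fibers (I J : finType) (q : I -> R) (c : I -> J) (F : J -> V) :
  \sum_a q a *: F (c a) = \sum_b (\sum_a q a * (c a == b)%:R) *: F b.
Proof.
rewrite (partition_big c predT)//=; apply: eq_bigr => b _.
rewrite scaler_suml big_mkcond/=; apply: eq_bigr => a _.
by case: eqP => [->|_]; rewrite ?mulr1// mulr0 scale0r.
Qed.

(* If [q_j] is the law of a variable equal to [0] with probability [1/k] and to [j]
   otherwise, then [delta_0 = k q_j - (k - 1) delta_j]; this is the product of
   these relations over [j], expanded. In the argument of [F], [true] stands for
   the choice of [0]. *)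
Lemma undecoupling_identity (k : nat) (F : {ffun 'I_k -> bool} -> V) : (0 < k)%N ->
  \sum_(a : {ffun 'I_k -> bool}) (\prod_j (if a j then k%:R else 1 - k%:R)) *:
    (k%:R^-1 ^+ k *: \sum_(v : {ffun 'I_k -> 'I_k}) F [ffun j => (v j == j) && a j]) =
  F [ffun=> true].
Proof.
move=> k0; have k0R : k%:R != 0 :> R by rewrite pnatr_eq0 -lt0n.
pose q (b : bool) : R := (if b then k%:R else 1 - k%:R) / k%:R.
transitivity (\sum_(p : {ffun 'I_k -> bool} * {ffun 'I_k -> 'I_k})
   (\prod_j q (p.1 j)) *: F [ffun j => (p.2 j == j) && p.1 j]).
  rewrite -(pair_big predT predT (fun (a : {ffun 'I_k -> bool}) (v : {ffun 'I_k -> 'I_k}) =>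
     (\prod_j q (a j)) *: F [ffun j => (v j == j) && a j]))/=.
  apply: eq_bigr => a _; rewrite scalerA -scaler_sumr; congr (_ *: _).
  by rewrite /q big_split/= prodr_const card_ord.
rewrite (sum_fibers (fun p : {ffun 'I_k -> bool} * {ffun 'I_k -> 'I_k} => \prod_j q (p.1 j))
  (fun p : {ffun 'I_k -> bool} * {ffun 'I_k -> 'I_k} => [ffun j => (p.2 j == j) && p.1 j])).
(* The coefficient of [F c] factors over [j]: the factor is [k / k = 1] if [c j] holds and
   [(k - 1) + (1 - k) = 0] otherwise. *)
have coefE (c : {ffun 'I_k -> bool}) :
    \sum_(p : {ffun 'I_k -> bool} * {ffun 'I_k -> 'I_k})
      (\prod_j q (p.1 j)) * ([ffun j => (p.2 j == j) && p.1 j] == c)%:R =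
    [forall j, c j]%:R :> R.
  rewrite -prodr_bool.
  rewrite (eq_bigr (fun j => \sum_(b : bool) \sum_(x : 'I_k)
      q b * (((x == j) && b) == c j)%:R)); last first.
    move=> j _; rewrite big_bool /= /q.
    under eq_bigr do rewrite divff// mul1r andbT.
    under [X in _ + X]eq_bigr do rewrite andbF.
    rewrite sumr_const card_ord; case: (c j) => /=.
      by rewrite mulr0 mul0rn addr0 (bigD1 j)//= eqxx big1 ?addr0// => x /negbTE ->.
    rewrite mulr1 (bigD1 j)//= eqxx add0r.
    rewrite (eq_bigr (fun=> 1)) => [|x /negbTE -> //].
    rewrite sumr_const cardC1 card_ord -[_ *+ k]mulr_natr mulfVK//.
    by rewrite -{2}(prednK k0) -natr1; ring.
  rewrite bigA_distr_bigA /=.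
  under [RHS]eq_bigr do rewrite bigA_distr_bigA /=.
  rewrite pair_big /=; apply: eq_bigr => -[a v] _ /=.
  rewrite [RHS]big_split /=; congr (_ * _).
  rewrite (prodr_bool (fun j => ((v j == j) && a j) == c j)); congr _%:R; congr nat_of_bool.
  apply/eqP/forallP => [<- j|h]; first by rewrite ffunE.
  by apply/ffunP => j; rewrite ffunE; apply/eqP.
rewrite (bigD1 [ffun=> true])//= [X in _ + X]big1 ?addr0 => [|c cT].
  by rewrite coefE (_ : [forall j, _] = true) ?scale1r//; apply/forallP => j; rewrite ffunE.
rewrite coefE (_ : [forall j, _] = false) ?scale0r//; apply: contraNF cT => /forallP cT.
by apply/eqP/ffunP => j; rewrite ffunE cT.
Qed.

(** Inclusion-exclusion over the allowed values [a]: the coefficient of [F v] is the product over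
    [r] of the indicators that [v] takes the value [r], so only surjective, hence injective, [v]
    survive. *)
Lemma polarization_identity (k : nat) (F : {ffun 'I_k -> 'I_k} -> V) :
  \sum_(a : {ffun 'I_k -> bool}) (\prod_r (if a r then 1 else -1)) *:
    \sum_(v : {ffun 'I_k -> 'I_k} | [forall j, a (v j)]) F v =
  \sum_(v : {ffun 'I_k -> 'I_k} | injectiveb v) F v.
Proof.
transitivity (\sum_(v : {ffun 'I_k -> 'I_k}) (\sum_(a : {ffun 'I_k -> bool})
   (\prod_r (if a r then 1 else -1)) * [forall j, a (v j)]%:R : R) *: F v).
  under [RHS]eq_bigr do rewrite scaler_suml.
  rewrite exchange_big /=; apply: eq_bigr => a _.
  rewrite scaler_sumr big_mkcond; apply: eq_bigr => v _.
  by case: ifP => _; rewrite ?mulr1// mulr0 scale0r.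
rewrite [RHS]big_mkcond; apply: eq_bigr => v _.
suff -> : \sum_(a : {ffun 'I_k -> bool})
   (\prod_r (if a r then 1 else -1)) * [forall j, a (v j)]%:R = (injectiveb v)%:R :> R.
  by case: (injectiveb v); rewrite ?scale1r// scale0r.
transitivity (\prod_r (r \in codom v)%:R : R); last first.
  rewrite (prodr_bool (fun r => r \in codom v)); congr _%:R; congr nat_of_bool.
  apply/forallP/injectiveP => [vT|v_inj r]; last first.
    by have [g vK gK] := injF_bij v_inj; rewrite -(gK r) codom_f.
  have /image_injP h : #|image_mem v (mem 'I_k)| == #|'I_k|.
    by apply/eqP; apply: eq_card => r; rewrite vT.
  by move=> x y; apply: h.
rewrite (eq_bigr (fun r => \sum_(b : bool)
  (if b then 1 else -1) * (b || (r \notin codom v))%:R)); last first.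
  by move=> r _; rewrite big_bool /=; case: (r \in codom v) => /=; ring.
rewrite bigA_distr_bigA /=; apply: eq_bigr => a _.
rewrite big_split /=; congr (_ * _).
rewrite (prodr_bool (fun r => a r || (r \notin codom v))); congr _%:R; congr nat_of_bool.
apply/forallP/forallP => [h r|h j].
  have [/codomP[j ->]|] := boolP (r \in codom v); last by rewrite orbT.
  by rewrite h.
by have := h (v j); rewrite codom_f orbF.
Qed.


End identities.

(** * Tails of off-diagonal sums *)

Lemma prob_le_bigcup d (T : measurableType d) (R : realType) (P : probability T R)
    (I : finType) (A : set T) (F : I -> set T) (p : \bar R) :
  measurable A -> (forall i, measurable (F i)) -> A `<=` \bigcup_i F i ->
  (forall i, (P (F i) <= p)%E) -> (P A <= #|I|%:R%:E * p)%E.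
Proof.
move=> mA mF AF Fp.
have h (s : seq I) : (P (\big[setU/set0]_(i <- s) F i) <= (size s)%:R%:E * p)%E.
  elim: s => [|i s IHs]; first by rewrite big_nil measure0 mul0e.
  rewrite big_cons /=; apply: le_trans (measureU2 _ _ _) _ => //.
    exact: bigsetU_measurable.
  rewrite -natr1 EFinD addeC ge0_muleDl ?lee_fin// mul1e.
  exact: leeD (Fp i) IHs.
rewrite cardE; apply: le_trans (h (enum I)).
rewrite big_enum /=; apply: le_measure; rewrite ?inE//.
  exact: bigsetU_measurable.
by move=> x /AF[i _ Fi]; rewrite -bigcup_seq/=; exists i => //=; rewrite mem_index_enum.
Qed.

(** [offdiag_sum] as a function of a deterministic array indexed by pairs (argument, index), so that
    its tails depend only on the law of the array. *)
Definition ustat (R : realType) (B : completeNormedModType R) (S : Type) (k n : nat)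
    (f : {ffun 'I_k -> 'I_n} -> k.-tuple S -> B) (x : 'I_k * 'I_n -> S) : B :=
  \sum_(i : {ffun 'I_k -> 'I_n} | injectiveb i) f i [tuple x (j, i j) | j < k].

Lemma measurable_tuple_of_array (I : finType) (d : measure_display)
    (S : measurableType d) (k : nat) (phi : 'I_k -> I) :
  measurable_fun setT (fun x : array I S => [tuple x (phi j) | j < k]).
Proof.
apply/measurable_fun_tnthP => j; rewrite (_ : _ \o _ = fun x : array I S => x (phi j)).
  exact: measurable_eval.
by apply/funext => x /=; rewrite tnth_mktuple.
Qed.

Section ustat.
Context (R : realType) (B : completeNormedModType R) (dS : measure_display)
  (S : measurableType dS) (k n : nat) (f : {ffun 'I_k -> 'I_n} -> k.-tuple S -> B).
Hypothesis sf : forall i, strongly_measurable (f i).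

Lemma strongly_measurable_ustat (I : finType) (phi : 'I_k * 'I_n -> I) :
  strongly_measurable (fun x : array I S => ustat f (fun p => x (phi p))).
Proof.
apply: strongly_measurable_sum => i _.
exact: (strongly_measurable_comp (sf i)
  (measurable_tuple_of_array (fun j => phi (j, i j)))).
Qed.

(** For each injective [i], [average_distinct_letters] turns the mean over words into a mean over
    independent letters, and [undecoupling_identity] applies to that term. *)
Lemma ustat_undecoupled (x : 'I_k.+1 -> 'I_n -> S) : (0 < k)%N ->
  ustat f (fun p => x ord0 p.2) =
  \sum_(a : {ffun 'I_k -> bool}) (\prod_j (if a j then k%:R else 1 - k%:R)) *:
    (#|'I_k|%:R^-1 ^+ n *: \sum_(w : n.-tuple 'I_k)
      ustat f (fun p => x (if (tnth w p.2 == p.1) && a p.1 then ord0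
                           else lift ord0 p.1) p.2)).
Proof.
move=> k0; rewrite /ustat.
under [RHS]eq_bigr do rewrite exchange_big scaler_sumr scaler_sumr /=.
rewrite [RHS]exchange_big /=; apply: eq_bigr => i /injectiveP i_inj.
pose F (c : {ffun 'I_k -> bool}) :=
  f i [tuple x (if c j then ord0 else lift ord0 j) (i j) | j < k].
have <- : F [ffun=> true] = f i [tuple x ord0 (i j) | j < k].
  by congr f; apply: eq_from_tnth => j; rewrite !tnth_mktuple ffunE.
rewrite -undecoupling_identity//; apply: eq_bigr => a _; congr (_ *: _).
have := average_distinct_letters (R := R)
  (fun v : {ffun 'I_k -> 'I_k} => F [ffun j => (v j == j) && a j]) i_inj.
rewrite !card_ord => /(_ k0) <-.
congr (_ *: _); apply: eq_bigr => w _.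
by congr f; apply: eq_from_tnth => j; rewrite !tnth_mktuple !ffunE.
Qed.

Lemma sum_inj_perm (F : {ffun 'I_k -> 'I_k} -> B) :
  \sum_(v : {ffun 'I_k -> 'I_k} | injectiveb v) F v = \sum_(s : 'S_k) F [ffun j => s j].
Proof.
rewrite (reindex_onto (fun s : 'S_k => [ffun j => s j]) (fun v => insubd (1%g : 'S_k) v)) /=.
  apply: eq_bigl => s.
  have -> : [ffun j => s j] = val s by apply/ffunP => j; rewrite ffunE pvalE.
  rewrite valKd eqxx andbT. exact: (valP s).
by move=> v v_inj; apply/ffunP => j; rewrite ffunE -pvalE insubdK.
Qed.

(** As before, but with [polarization_identity]; the factor [#|{: {r | a r}}|%:R ^+ k] turns the
    mean over letters back into the sum that polarization needs. *)
Lemma ustat_symmetrized (x : 'I_k.+1 -> 'I_n -> S) : (0 < k)%N ->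
  \sum_(i : {ffun 'I_k -> 'I_n} | injectiveb i) \sum_(s : 'S_k)
    f i [tuple x (lift ord0 (s j)) (i j) | j < k] =
  \sum_(a : {ffun 'I_k -> bool})
    ((\prod_r (if a r then 1 else -1)) * #|{: {r | a r}}|%:R ^+ k) *:
    (#|{: {r | a r}}|%:R^-1 ^+ n *: \sum_(w : n.-tuple {r | a r})
      ustat f (fun p => x (lift ord0 (val (tnth w p.2))) p.2)).
Proof.
move=> k0; rewrite /ustat.
under [RHS]eq_bigr do rewrite exchange_big scaler_sumr scaler_sumr /=.
rewrite [RHS]exchange_big /=; apply: eq_bigr => i /injectiveP i_inj.
pose F (v : {ffun 'I_k -> 'I_k}) := f i [tuple x (lift ord0 (v j)) (i j) | j < k].
transitivity (\sum_(s : 'S_k) F [ffun j => s j]).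
  apply: eq_bigr => s _; congr f.
  by apply: eq_from_tnth => j; rewrite !tnth_mktuple ffunE.
rewrite -sum_inj_perm -polarization_identity; apply: eq_bigr => a _.
rewrite -scalerA; congr (_ *: _).
(* For empty [a] both sides vanish because [k > 0]. *)
have [K0|] := posnP #|{: {r | a r}}|.
  rewrite K0 expr0n (gtn_eqF k0) scale0r big1// => v /forallP/(_ (Ordinal k0)) av.
  by have := card0_eq K0 (exist (fun r => a r) _ av); rewrite inE.
move=> K0; have /card_gt0P[c0 _] := K0.
rewrite -(sum_ffun_sub c0 F).
transitivity (#|{: {r | a r}}|%:R ^+ k *: (#|{: {r | a r}}|%:R^-1 ^+ n *:
   \sum_(w : n.-tuple {r | a r})
     (fun v : {ffun 'I_k -> {r | a r}} => F [ffun j => val (v j)]) [ffun j => tnth w (i j)])).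
  rewrite (average_distinct_letters
    (fun v : {ffun 'I_k -> {r | a r}} => F [ffun j => val (v j)]) i_inj)//.
  by rewrite scalerA -exprMn divff ?expr1n ?scale1r// pnatr_eq0 -lt0n.
congr (_ *: (_ *: _)); apply: eq_bigr => w _; congr f.
by apply: eq_from_tnth => j; rewrite !tnth_mktuple !ffunE.
Qed.

End ustat.

(* The bound of [anticoncentration] for [k] letters and degree [k]. *)
Definition tail_cst (R : realType) (k : nat) : R :=
  (4 * ((16 + 3 * k%:R) ^+ k.+1) ^+ 2)^-1.

Lemma tail_cst_gt0 (R : realType) k : 0 < tail_cst R k.
Proof.
by rewrite invr_gt0 mulr_gt0// exprn_gt0// exprn_gt0// ltr_wpDr ?mulr_ge0.
Qed.

Lemma tail_cst_le1 (R : realType) k : tail_cst R k <= 1.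
Proof.
rewrite invf_le1 ?mulr_gt0 ?exprn_gt0 ?ltr_wpDr ?mulr_ge0//.
have h : 1 <= ((16 + 3 * k%:R) ^+ k.+1) ^+ 2 :> R.
  rewrite exprn_ege1// exprn_ege1//.
  have : 0 <= k%:R :> R by [].
  lra.
lra.
Qed.

Section tails.
Context (R : realType) (B : completeNormedModType R) (dS : measure_display)
  (S : measurableType dS) (k n : nat) (f : {ffun 'I_k -> 'I_n} -> k.-tuple S -> B).
Hypothesis sf : forall i, strongly_measurable (f i).
Context (dO : measure_display) (O : measurableType dO) (Q : probability O R)
  (V : 'I_k.+1 -> 'I_n -> O -> S).
Hypothesis mV : forall j i, measurable_fun setT (V j i).

Lemma strongly_measurable_ustat_sel (sel : 'I_k * 'I_n -> 'I_k.+1) :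
  strongly_measurable (fun o => ustat f (fun p => V (sel p) p.2 o)).
Proof.
exact: (strongly_measurable_comp (strongly_measurable_ustat sf id)
  (measurable_array (fun p => mV (sel p) p.2))).
Qed.

(** At a fixed outcome, [anticoncentration_norm] shows that a proportion at least [tail_cst R k] of
    the words give a value at least as large in norm as the mean over words; [prob_le_average]
    integrates this. *)
Lemma tail_average_le (K : finType) (sel : K -> 'I_k -> 'I_k.+1) (t : R) (q : \bar R) :
  (0 < #|K|)%N -> (#|K| <= k)%N ->
  (forall w : n.-tuple K,
    Q [set o | (t <= `|ustat f (fun p => V (sel (tnth w p.2) p.1) p.2 o)|)%R] = q) ->
  ((tail_cst R k)%:E * Q [set o | (t <= `|#|K|%:R^-1 ^+ n *: \sum_(w : n.-tuple K)
     ustat f (fun p => V (sel (tnth w p.2) p.1) p.2 o)|)%R] <= q)%E.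
Proof.
move=> K0 Kk wq; have K0R : #|K|%:R != 0 :> R by rewrite pnatr_eq0 -lt0n.
have /card_gt0P/sigW[c0 _] := K0.
have sU (w : n.-tuple K) :
    strongly_measurable (fun o => ustat f (fun p => V (sel (tnth w p.2) p.1) p.2 o)).
  exact: (strongly_measurable_ustat_sel (fun p => sel (tnth w p.2) p.1)).
apply: (prob_le_average (a := #|K|%:R^-1 ^+ n) _ _ _ _ _ _ wq).
- by rewrite exprn_ge0.
- exact/ltW/tail_cst_gt0.
- by rewrite card_tuple natrX -exprMn mulVf// expr1n.
- apply: measurable_norm_ge; apply: strongly_measurableZ.
  by apply: strongly_measurable_sum => w _; exact: sU.
- by move=> w; exact: measurable_norm_ge.
move=> o /= to.
pose g (i : {ffun 'I_k -> 'I_n}) (w : seq K) :=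
  f i [tuple V (sel (nth c0 w (i j)) j) (i j) o | j < k].
(* The term of index [i] reads the word only at the positions [i j], at most [k] of them. *)
pose supp (i : {ffun 'I_k -> 'I_n}) : pred nat := [pred x | [exists j, val (i j) == x]].
have := @anticoncentration_norm R B K c0 k%:R k n {ffun 'I_k -> 'I_n}
  (fun i => injectiveb i) g supp.
have gE (w : n.-tuple K) : \sum_(i : {ffun 'I_k -> 'I_n} | injectiveb i) g i w =
    ustat f (fun p => V (sel (tnth w p.2) p.1) p.2 o).
  apply: eq_bigr => i _; congr f; apply: eq_from_tnth => j.
  by rewrite !tnth_mktuple /= (tnth_nth c0).
cbv zeta beta; rewrite (eq_bigr _ (fun w _ => gE w)).
move=> /(_ _ _ _)/le_trans; apply.
- by rewrite ler_nat.
- move=> i _; rewrite -size_filter.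
  rewrite -[leqRHS](size_enum_ord k) -(size_map (fun j => val (i j))).
  apply: uniq_leq_size; first by rewrite filter_uniq// iota_uniq.
  move=> x; rewrite mem_filter => /andP[/existsP[j /eqP <-] _].
  by apply/mapP; exists j; rewrite ?mem_enum.
- move=> i w w' _ _ _ ww'; congr f; apply: eq_from_tnth => j.
  rewrite !tnth_mktuple; congr (V (sel _ _) _ _); apply: ww' => //.
  by apply/existsP; exists j.
rewrite mean_tuple// ler_wpM2l ?exprn_ge0//; apply: ler_sum => w _.
rewrite indicE gE ler_nat; case: leP => //= h.
by rewrite mem_set//=; exact: le_trans to h.
Qed.

(** The law of an entry depends only on its column, so any family of distinct entries of [V] is
    distributed like independent variables with the laws of the same columns. *)
Lemma tail_reindex (mu : 'I_n -> set S -> \bar R) (dT : measure_display)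
    (T : measurableType dT) (P : probability T R) (J : finType)
    (phi : J -> 'I_k.+1 * 'I_n) (W : J -> T -> S) (E : set (array J S)) :
  injective phi -> (forall i, mu i setT = 1%E) ->
  (forall j, measurable_fun setT (W j)) ->
  product_law Q (fun p : 'I_k.+1 * 'I_n => V p.1 p.2) (fun p => mu p.2) ->
  product_law P W (fun j => mu (phi j).2) -> measurable E ->
  Q [set o | E (fun j => V (phi j).1 (phi j).2 o)] = P [set w | E (fun j => W j w)].
Proof.
move=> phi_inj mu1 mW lawV lawW mE.
have lawV' := product_law_reindex phi_inj (fun p => mu1 p.2) lawV.
exact: (product_law_unique (fun j => mV (phi j).1 (phi j).2) mW lawV' lawW mE).
Qed.

(** Off the null set [N], if every [M i] had norm below [tau], then [v] would have norm below [t];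
    the rest is a union bound. The index [i0] makes the inequality strict and lets [N] be absorbed
    in the union. *)
Lemma tail_le_sum (I : finType) (i0 : I) (b : I -> R) (M : I -> O -> B) (N : set O)
    (v : O -> B) (beta t tau : R) (q : \bar R) :
  0 < beta -> (forall i, `|b i| <= beta) -> #|I|%:R * beta * tau <= t ->
  (forall i, strongly_measurable (M i)) -> strongly_measurable v ->
  measurable N -> Q N = 0%E ->
  (forall o, ~ N o -> v o = \sum_i b i *: M i o) ->
  (forall i, (Q [set o | (tau <= `|M i o|)%R] <= q)%E) ->
  (Q [set o | (t <= `|v o|)%R] <= #|I|%:R%:E * q)%E.
Proof.
move=> beta0 bb tau_le sM sv mN N0 vE Mq.
have mM i : measurable [set o | (tau <= `|M i o|)%R] by exact: measurable_norm_ge.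
apply: (prob_le_bigcup (F := fun i => [set o | (tau <= `|M i o|)%R] `|` N)).
- exact: measurable_norm_ge.
- by move=> i; exact: measurableU.
- move=> o /= tv; apply: contrapT => hN.
  have No : ~ N o by move=> No; apply: hN; exists i0 => //; right.
  have Mo i : `|M i o| < tau.
    by rewrite ltNge; apply/negP => Mi; apply: hN; exists i => //; left.
  have : `|v o| < t; last by rewrite ltNge tv.
  apply: lt_le_trans tau_le; rewrite vE//.
  apply: (@le_lt_trans _ _ (\sum_i beta * `|M i o|)).
    apply: le_trans (ler_norm_sum _ _ _) _; apply: ler_sum => i _.
    by rewrite normrZ ler_wpM2r.
  rewrite -mulrA mulr_natl -sumr_const (bigD1 i0)//= [ltRHS](bigD1 i0)//=.
  apply: ltr_leD; first by rewrite ltr_pM2l.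
  by apply: ler_sum => i _; rewrite ler_pM2l// ltW.
move=> i; apply: le_trans (Mq i); rewrite le_eqVlt; apply/orP; left; apply/eqP.
exact: measureU0.
Qed.

End tails.

(** * The two decoupling inequalities *)

Section decoupling.
Context (R : realType) (k n : nat) (dS : measure_display) (S : measurableType dS)
  (B : completeNormedModType R) (dT : measure_display) (T : measurableType dT)
  (P : probability T R) (X : nat -> T -> S) (Y : 'I_k -> nat -> T -> S)
  (f : {ffun 'I_k -> 'I_n} -> k.-tuple S -> B).
Hypotheses (k0 : (0 < k)%N) (kn : (k <= n)%N)
  (mX : forall i, measurable_fun setT (X i))
  (mY : forall j i, measurable_fun setT (Y j i))
  (indX : mutually_independent P X) (indY : independent_copies P X Y)
  (sf : forall i, strongly_measurable (f i)).

Let Q : probability (T * T)%type R := (P \x P)%E.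
Let V (j : 'I_k.+1) (i : 'I_n) := adjoin_copy X Y j i.
Let mu (i : 'I_n) (A : set S) : \bar R := P (X i @^-1` A).

Let mV j i : measurable_fun setT (V j i).
Proof. exact: measurable_adjoin_copy. Qed.

Let mu1 i : mu i setT = 1%E.
Proof. by rewrite /mu preimage_setT probability_setT. Qed.

Let lawV : product_law Q (fun p : 'I_k.+1 * 'I_n => V p.1 p.2) (fun p => mu p.2).
Proof. exact: adjoin_copy_product_law. Qed.

Let measurable_tail (I : finType) (phi : 'I_k * 'I_n -> I) t :
  measurable [set x : array I S | (t <= `|ustat f (fun p => x (phi p))|)%R].
Proof. by apply: measurable_norm_ge; exact: strongly_measurable_ustat. Qed.

(** All arguments read the same row [s i] in column [i], so one entry per column is used and the
    selected array acts as [X]. *)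
Lemma undecoupled_tail t (s : 'I_n -> 'I_k.+1) :
  Q [set o | (t <= `|ustat f (fun p => V (s p.2) p.2 o)|)%R] =
  P [set w | (t <= `|offdiag_sum f (fun _ i => X i) w|)%R].
Proof.
apply: (tail_reindex mV (phi := fun i => (s i, i)) (W := fun i : 'I_n => X i) _ mu1 _ lawV _
  (@measurable_tail 'I_n snd t)).
- by move=> i i' [].
- by [].
- exact: (mutually_independent_product_law (@ord_inj n) indX).
Qed.

(** In each column different arguments read different rows, so all [k * n] selected entries are
    distinct, hence independent. *)
Lemma decoupled_tail t (sel : 'I_n -> 'I_k -> 'I_k.+1) :
  (forall i, injective (sel i)) ->
  Q [set o | (t <= `|ustat f (fun p => V (sel p.2 p.1) p.2 o)|)%R] =
  P [set w | (t <= `|offdiag_sum f Y w|)%R].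
Proof.
move=> sel_inj.
apply: (tail_reindex mV (phi := fun p : 'I_k * 'I_n => (sel p.2 p.1, p.2))
  (W := fun p : 'I_k * 'I_n => Y p.1 p.2) _ mu1 _ lawV _
  (@measurable_tail ('I_k * 'I_n)%type id t)).
- move=> [j i] [j' i'] /= [sj ij]; rewrite -ij in sj *.
  by rewrite (sel_inj i _ _ sj).
- by [].
- exact: (independent_copies_product_law (n := n) indX indY).
Qed.

Let scale_tail (q p : \bar R) :
  ((tail_cst R k)%:E * q <= p)%E -> (q <= (tail_cst R k)^-1%:E * p)%E.
Proof.
move=> h; have c0 := tail_cst_gt0 R k.
have := @lee_wpmul2l _ (tail_cst R k)^-1%:E _ _ _ h.
rewrite lee_fin invr_ge0 ltW// => /(_ isT).
by rewrite muleA -EFinM mulVf ?gt_eqF// mul1e.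
Qed.

Let card_choices : #|{ffun 'I_k -> bool}| = (2 ^ k)%N.
Proof. by rewrite card_ffun card_bool card_ord. Qed.

(** The sum of [ustat_undecoupled] has [2^k] terms with coefficients at most [k^k], whence the
    threshold [t / (2k)^k]; the union bound costs [2^k] and each mean costs [1 / tail_cst R k]. *)
Lemma decoupling_upper t : 0 < t ->
  (P [set w | (t <= `|offdiag_sum f (fun _ i => X i) w|)%R] <=
   (2 ^+ k / tail_cst R k)%:E *
   P [set w | (t / (2 * k%:R) ^+ k <= `|offdiag_sum f Y w|)%R])%E.
Proof.
move=> t0; rewrite -(undecoupled_tail t (fun=> ord0)).
have k1 : 1 <= k%:R :> R by rewrite ler1n.
pose sel (a : {ffun 'I_k -> bool}) (c j : 'I_k) :=
  if (c == j) && a j then ord0 else lift ord0 j.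
pose M a o := #|'I_k|%:R^-1 ^+ n *: \sum_(w : n.-tuple 'I_k)
  ustat f (fun p => V (sel a (tnth w p.2) p.1) p.2 o).
have sM a : strongly_measurable (M a).
  apply: strongly_measurableZ; apply: strongly_measurable_sum => w _.
  exact: (strongly_measurable_ustat_sel sf mV (fun p => sel a (tnth w p.2) p.1)).
(* Only the argument [j = c] can read row [0]; any other reads its own row [lift ord0 j]. *)
have sel_inj a c : injective (sel a c).
  move=> j j'; rewrite /sel.
  case: (c =P j) => [<-|_]; case: (c =P j') => [<-|_] //=.
  - by case: (a c) => [/eqP|/lift_inj//]; rewrite (negbTE (neq_lift _ _)).
  - by case: (a c) => [/eqP|/lift_inj//]; rewrite eq_sym (negbTE (neq_lift _ _)).
  - exact: lift_inj.
rewrite EFinM -muleA -natrX -card_choices.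
apply: (tail_le_sum [ffun=> true] (b := fun a : {ffun 'I_k -> bool} =>
    \prod_j (if a j then k%:R else 1 - k%:R)) (M := M) (N := set0)
  (beta := k%:R ^+ k) (tau := t / (2 * k%:R) ^+ k)) => //.
- by rewrite exprn_gt0// ltr0n.
- move=> a; rewrite normr_prod -[X in _ <= _ ^+ X](card_ord k) -prodr_const.
  apply: ler_prod => j _; rewrite normr_ge0/=.
  by case: (a j); rewrite ler_norml; apply/andP; split; lra.
- rewrite card_choices natrX -exprMn mulrC divfK// expf_neq0// mulf_neq0 ?pnatr_eq0//.
  by rewrite -lt0n.
- exact: (strongly_measurable_ustat_sel sf mV (fun=> ord0)).
- by move=> o _; exact: (ustat_undecoupled f (fun j i => V j i o) k0).
move=> a; apply: scale_tail; apply: tail_average_le => //; rewrite ?card_ord//.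
by move=> w; apply: (decoupled_tail _ (sel := fun i => sel a (tnth w i))).
Qed.

(** * The reverse inequality for symmetric kernels *)

Section symmetric.
Hypothesis fsym : forall (i : {ffun 'I_k -> 'I_n}) (s : 'S_k), injectiveb i ->
  {ae P, forall w, f i [tuple X (i j) w | j < k] =
     f [ffun j => i (s j)] [tuple X (i (s j)) w | j < k]}.

(** The outcomes at which the symmetry of [f], assumed along [X], fails along the decoupled
    entries. *)
Let asym (p : {ffun 'I_k -> 'I_n} * 'S_k) : set (T * T) :=
  if injectiveb p.1 then
    [set o | f p.1 [tuple V (lift ord0 (p.2 j)) (p.1 j) o | j < k] <>
      f [ffun j => p.1 ((p.2^-1)%g j)]
        [tuple V (lift ord0 j) (p.1 ((p.2^-1)%g j)) o | j < k]]
  else set0.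

(** As [i] is injective, the entries involved lie in distinct columns and have the joint law of the
    [X (i j)], so the almost sure symmetry carries over. *)
Let measurable_asym p : measurable (asym p) /\ Q (asym p) = 0%E.
Proof.
rewrite /asym; case: (boolP (injectiveb p.1)) => [i_inj|_]; last by rewrite measure0.
case: p i_inj => i s /= ib; have i_inj := injectiveP _ ib.
pose E := ~` [set x : array 'I_k S | f i [tuple x j | j < k] =
  f [ffun j => i ((s^-1)%g j)] [tuple x ((s^-1)%g j) | j < k]].
have mE : measurable E.
  apply: measurableC; apply: (measurable_eq
    (f := f i \o (fun x : array 'I_k S => [tuple x j | j < k]))
    (g := f [ffun j => i ((s^-1)%g j)] \o
          (fun x : array 'I_k S => [tuple x ((s^-1)%g j) | j < k]))).
    exact: (strongly_measurable_comp (sf i) (measurable_tuple_of_array id)).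
  exact: (strongly_measurable_comp (sf _) (measurable_tuple_of_array _)).
rewrite (_ : [set o | _] = [set o | E (fun j => V (lift ord0 (s j)) (i j) o)]); last first.
  rewrite /E /setC /=; apply/seteqP; split=> o /=; apply: contra_not => ->; congr f;
    by apply: eq_from_tnth => j; rewrite !tnth_mktuple permKV.
have mW : measurable_fun setT ((fun o j => V (lift ord0 (s j)) (i j) o) : _ -> array 'I_k S).
  by apply: measurable_array => j; exact: mV.
split; first by rewrite -[X in measurable X]setTI; exact: mW.
rewrite (tail_reindex mV (P := P) (phi := fun j : 'I_k => (lift ord0 (s j), i j))
  (W := fun j : 'I_k => X (i j)) _ mu1 _ lawV _ mE) //.
- have mWX : measurable_fun setT ((fun w j => X (i j) w) : _ -> array 'I_k S).
    by apply: measurable_array => j; exact: mX.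
  apply: measure_negligible; first by rewrite -[X in measurable X]setTI; exact: mWX.
  exact: (fsym (s^-1)%g ib).
- by move=> j j' [_ /i_inj].
- by apply: (mutually_independent_product_law (phi := fun j => val (i j)))
    => // j j' /val_inj/i_inj.
Qed.

Let N : set (T * T) := \bigcup_p asym p.

Let measurable_N : measurable N.
Proof.
by apply: fin_bigcup_measurable => [|p _]; [exact: finite_finset|case: (measurable_asym p)].
Qed.

Let null_N : Q N = 0%E.
Proof.
apply/eqP; rewrite eq_le measure_ge0 andbT.
have := @prob_le_bigcup _ _ R Q _ N asym 0%E measurable_N.
rewrite mule0; apply=> // p; first by case: (measurable_asym p).
by case: (measurable_asym p) => _ ->.
Qed.

(** Off [N], replacing [i] by its composition with the inverse of [s] permutes the injective indices
    and turns the summand of each [s] into the same decoupled sum. *)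
Let symmetrized o : ~ N o ->
  \sum_(i : {ffun 'I_k -> 'I_n} | injectiveb i) \sum_(s : 'S_k)
    f i [tuple V (lift ord0 (s j)) (i j) o | j < k] =
  k`!%:R *: ustat f (fun p => V (lift ord0 p.1) p.2 o).
Proof.
move=> No; rewrite exchange_big /= scaler_nat -[X in _ *+ X](card_Sn k) -sumr_const.
apply: eq_big => [s|s _]; first by rewrite !inE.
pose h (i : {ffun 'I_k -> 'I_n}) := [ffun j => i ((s^-1)%g j)].
have h_inj : injective h.
  move=> i i' /ffunP hi; apply/ffunP => j; have := hi (s j).
  by rewrite !ffunE permK.
rewrite /ustat [RHS](reindex_inj h_inj) /=; apply: eq_big => [i|i ib].
  apply/injectiveP/injectiveP => i_inj j j'.
    by rewrite !ffunE => /i_inj/perm_inj.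
  by move=> ij; apply: (@perm_inj _ s); apply: i_inj; rewrite !ffunE !permK.
apply: contrapT => neq; apply: No; exists (i, s) => //.
rewrite /asym ib /= => e; apply: neq; rewrite e; congr f.
by apply: eq_from_tnth => j; rewrite !tnth_mktuple ffunE.
Qed.

(** Divide [ustat_symmetrized] by the factorial of [k]: again [2^k] terms with coefficients at most
    [k^k]. Within one mean every argument reads the row named by the letter of its column, so each
    selection has the tail of the undecoupled sum. *)
Lemma decoupling_lower t : 0 < t ->
  (P [set w | ((2 * k%:R) ^+ k * t <= `|offdiag_sum f Y w|)%R] <=
   (2 ^+ k / tail_cst R k)%:E *
   P [set w | (t <= `|offdiag_sum f (fun _ i => X i) w|)%R])%E.
Proof.
move=> t0; rewrite -(decoupled_tail _ (sel := fun _ j => lift ord0 j)); last first.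
  by move=> _; exact: lift_inj.
have k1 : 1 <= k%:R :> R by rewrite ler1n.
have fact1 : 1 <= k`!%:R :> R by rewrite ler1n fact_gt0.
pose M (a : {ffun 'I_k -> bool}) o := #|{: {r | a r}}|%:R^-1 ^+ n *:
  \sum_(w : n.-tuple {r | a r})
    ustat f (fun p => V (lift ord0 (val (tnth w p.2))) p.2 o).
have sM a : strongly_measurable (M a).
  apply: strongly_measurableZ; apply: strongly_measurable_sum => w _.
  exact: (strongly_measurable_ustat_sel sf mV (fun p => lift ord0 (val (tnth w p.2)))).
have cardK (a : {ffun 'I_k -> bool}) : (#|{: {r | a r}}| <= k)%N.
  by rewrite card_sig -[leqRHS](card_ord k) max_card.
rewrite EFinM -muleA -natrX -card_choices.
apply: (tail_le_sum [ffun=> true] (b := fun a : {ffun 'I_k -> bool} => k`!%:R^-1 *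
    ((\prod_r (if a r then 1 else -1)) * #|{: {r | a r}}|%:R ^+ k)) (M := M) (N := N)
  (beta := k%:R ^+ k) (tau := t)) => //.
- by rewrite exprn_gt0// ltr0n.
- move=> a; rewrite !normrM normr_prod big1 ?mul1r => [|r _]; last first.
    by case: (a r); rewrite ?normrN normr1.
  rewrite normfV !normrX !ger0_norm// -[leRHS]mul1r ler_pM ?invr_ge0 ?exprn_ge0//.
    by rewrite invf_le1//; lra.
  by rewrite lerXn2r ?nnegrE// ler_nat.
- by rewrite card_choices natrX -exprMn.
- exact: (strongly_measurable_ustat_sel sf mV (fun p => lift ord0 p.1)).
- move=> o No; under eq_bigr do rewrite -scalerA.
  rewrite -scaler_sumr -(ustat_symmetrized f (fun j i => V j i o) k0) symmetrized//.
  by rewrite scalerA mulVf ?scale1r//; lra.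
move=> a; apply: scale_tail.
(* For empty [a] there are no words, since [n > 0]; then [M a] is zero and cannot reach [t > 0]. *)
have [K0|K0] := posnP #|{: {r | a r}}|; last first.
  apply: (tail_average_le sf mV (sel := fun (c : {r | a r}) _ => lift ord0 (val c))) => // w.
  by apply: (undecoupled_tail _ (fun i => lift ord0 (val (tnth w i)))).
rewrite (_ : [set o | _] = set0) ?measure0 ?mule0//.
apply/seteqP; split=> // o /=; rewrite /M big1 ?scaler0 ?normr0; first by rewrite leNgt t0.
by move=> w; have := card0_eq K0 (tnth w (Ordinal (leq_trans k0 kn))); rewrite inE.
Qed.

End symmetric.

End decoupling.

Theorem theorem1 (R : realType) (k : nat) (hk : (1 <= k)%N) :
  exists C : R, 0 < C /\
  forall (dS : measure_display) (S : measurableType dS)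
    (B : completeNormedModType R)
    (dT : measure_display) (T : measurableType dT) (P : probability T R)
    (X : nat -> {RV P >-> S}) (Y : 'I_k -> nat -> {RV P >-> S})
    (n : nat) (f : {ffun 'I_k -> 'I_n} -> k.-tuple S -> B),
  mutually_independent P (fun i => X i : T -> S) ->
  independent_copies P (fun i => X i : T -> S) (fun j i => Y j i : T -> S) ->
  (k <= n)%N ->
  (forall i, strongly_measurable (f i)) ->
  (forall t : R, 0 < t ->
     (P [set w | (t <= `|offdiag_sum f (fun _ i => X i) w|)%R] <=
      C%:E * P [set w | (t <= C * `|offdiag_sum f (fun j i => Y j i) w|)%R])%E)
  /\
  ((forall (i : {ffun 'I_k -> 'I_n}) (s : 'S_k), injectiveb i ->
      {ae P, forall w,
         f i [tuple X (i j) w | j < k] =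
         f [ffun j => i (s j)] [tuple X (i (s j)) w | j < k]}) ->
   forall t : R, 0 < t ->
     ((C^-1)%:E *
        P [set w | (t <= C^-1 * `|offdiag_sum f (fun j i => Y j i) w|)%R] <=
      P [set w | (t <= `|offdiag_sum f (fun _ i => X i) w|)%R])%E).
Proof.
(* [D] is the loss in the threshold and [A] the loss in probability. Both are at least 1, so the
   single constant [D * A] dominates each. *)
pose D : R := (2 * k%:R) ^+ k; pose A : R := 2 ^+ k / tail_cst R k.
have k1 : 1 <= k%:R :> R by rewrite ler1n.
have D1 : 1 <= D by rewrite exprn_ege1//; lra.
have A1 : 1 <= A.
  rewrite /A -[leLHS]mulr1 ler_pM ?exprn_ege1 ?ler1n//.
  by rewrite invf_ge1 ?tail_cst_gt0// tail_cst_le1.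
have D0 : 0 < D by lra.
have A0 : 0 < A by lra.
have DA : D <= D * A by rewrite ler_peMr// ltW.
have AD : A <= D * A by rewrite ler_peMl// ltW.
have C0 : 0 < D * A by rewrite mulr_gt0.
exists (D * A); split=> // dS S B dT T P X Y n f indX indY kn sf.
have mX i : measurable_fun setT (X i : T -> S) by [].
have mY j i : measurable_fun setT (Y j i : T -> S) by [].
have mtail t : measurable [set w | (t <= `|offdiag_sum f (fun j i => Y j i) w|)%R].
  apply: (measurable_norm_ge (f := offdiag_sum f (fun j i => Y j i))).
  exact: (strongly_measurable_comp (strongly_measurable_ustat sf id)
    (measurable_array (W := fun p : 'I_k * 'I_n => Y p.1 p.2) (fun p => mY p.1 p.2))).
split=> [t t0|fsym t t0].
  apply: le_trans (decoupling_upper hk mX mY indX indY sf t0) _.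
  rewrite -/A -/D; apply: lee_pmul; rewrite ?lee_fin ?(ltW A0)//.
  rewrite (_ : [set w | (t <= D * A * _)%R] =
      [set w | (t / (D * A) <= `|offdiag_sum f (fun j i => Y j i) w|)%R]); last first.
    by apply/seteqP; split=> w /=; rewrite ler_pdivrMr// mulrC.
  apply: le_measure; rewrite ?inE// => w /=; apply: le_trans.
  by rewrite ler_pM2l// lef_pV2.
have := decoupling_lower hk kn mX mY indX indY sf fsym t0.
rewrite -/A -/D => h.
rewrite (_ : [set w | (t <= (D * A)^-1 * _)%R] =
    [set w | (D * A * t <= `|offdiag_sum f (fun j i => Y j i) w|)%R]); last first.
  by apply/seteqP; split=> w /=; rewrite ler_pdivlMl.
apply: (@le_trans _ _ ((A^-1)%:E * P
    [set w | (D * t <= `|offdiag_sum f (fun j i => Y j i) w|)%R])%E).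
  apply: lee_pmul; rewrite ?lee_fin ?invr_ge0 ?(ltW C0) ?lef_pV2//.
  apply: le_measure; rewrite ?inE// => w /=; apply: le_trans.
  by rewrite ler_pM2r.
apply: le_trans (lee_wpmul2l _ h) _; first by rewrite lee_fin invr_ge0 ltW.
by rewrite muleA -EFinM mulVf ?gt_eqF// mul1e.
Qed.
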